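(* Let $\beta<-1$ and let $\mu$ be a measure of maximal entropy on the negative $\beta$-shift $S_\beta$. Then $\mu({}_0[x])>0$ whenever $x$ can be decomposed into a product of words of the positive recurrent prefix (or suffix) code of the support of $\mu$. Let $t$ be an intransitive word of $L_\beta$. Then $\mu({}_0[t])=0$.
   Context: $l(w)$ is the length of a word $w$. Alternating order on sequences of nonnegative integers: $(x_i)_{i\ge1}\prec(y_i)_{i\ge1}$ iff there is $k\ge1$ with $x_i=y_i$ for all $i<k$ and $(-1)^k(x_k-y_k)<0$; $\preceq$ means $\prec$ or equal. For $\beta<-1$: $l_\beta=\frac{\beta}{1-\beta}$, $r_\beta=\frac{1}{1-\beta}$, $I_\beta=[l_\beta,r_\beta)$, $T_\beta:I_\beta\to I_\beta$, $T_\beta(y)=\beta y-\lfloor\beta y-l_\beta\rfloor$. The $\beta$-expansion of $l_\beta$ is $(d_i^* )_{i\ge1}$ with $d_i^*=\lfloor\beta T_\beta^{i-1}(l_\beta)-l_\beta\rfloor$. The characteristic sequence $(d_i)_{i\ge1}$ is the infinite repetition of $d_1^*\cdots d_{2p-2}^*(d_{2p-1}^*-1)0$ if $(d_i^* )$ is purely periodic with odd minimal period $2p-1$, and is $(d_i^* )_{i\ge1}$ otherwise. Put $(r_i)_{i\ge1}=(0,d_1,d_2,\dots)$. $S_\beta$ is the set of two-sided integer sequences $(x_i)_{i\in\mathbb{Z}}$ with $(d_i)_{i\ge1}\preceq(x_i)_{i\ge m}\preceq(r_i)_{i\ge1}$ for all $m\in\mathbb{Z}$, with the shift $\sigma$;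 $L_\beta$ is its language (set of finite factors, including the empty word). Its topological entropy is $\log|\beta|$; a measure of maximal entropy is a $\sigma$-invariant Borel probability measure with this entropy. ${}_0[w]$ is the set of $(x_i)\in S_\beta$ with $x_0\cdots x_{l(w)-1}=w$. The support of $\mu$ is coded by a code $P$: the language of the support is the set of factors of words of the free monoid $P^*$. A prefix (resp. suffix) code is a set of nonempty words none of which is a proper prefix (resp. suffix) of another. $P$ is positive recurrent if, with $\rho_{P^*}$ the radius of convergence of $\sum_n\mathrm{card}\{w\in P^*:l(w)=n\}z^n$, one has $\sum_{x\in P}\rho_{P^*}^{l(x)}=1$ and $\sum_{x\in P}l(x)\rho_{P^*}^{l(x)}<\infty$. A word $t\in L_\beta$ is intransitive if there exists $u\in L_\beta$ such that $uat\notin L_\beta$ for every $a\in L_\beta$. *)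

(* Defs.v *)
From HB Require Import structures.
From mathcomp Require Import all_boot all_order all_algebra.
From mathcomp Require Import finmap all_classical all_reals all_analysis.

Set Implicit Arguments.
Unset Strict Implicit.
Unset Printing Implicit Defensive.
Import Order.TTheory GRing.Theory Num.Theory.
Import numFieldNormedType.Exports.
Local Open Scope classical_set_scope.
Local Open Scope ring_scope.

(* One-sided sequences (x_i)_{i >= 1} are functions nat -> int, x_i being the
   value at i.-1; hence the sign (-1)^k of the order becomes (-1)^{k+1}. *)

Definition alt_lt (x y : nat -> int) : Prop :=
  exists k : nat, (forall i, (i < k)%N -> x i = y i) /\
    (-1) ^+ k.+1 * (x k - y k) < 0.

Definition alt_le (x y : nat -> int) : Prop := alt_lt x y \/ x = y.

Definition beta_l (R : realType) (beta : R) : R := beta / (1 - beta).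

Definition beta_T (R : realType) (beta y : R) : R :=
  beta * y - (Num.floor (beta * y - beta_l beta))%:~R.

Definition dstar (R : realType) (beta : R) (i : nat) : int :=
  Num.floor (beta * iter i (beta_T beta) (beta_l beta) - beta_l beta).

Definition period (s : nat -> int) (q : nat) : Prop :=
  (0 < q)%N /\ forall i, s (i + q)%N = s i.

Definition minimal_period (s : nat -> int) (q : nat) : Prop :=
  period s q /\ forall q', period s q' -> (q <= q')%N.

(* The minimal period of s, or 0 when s is not purely periodic. *)
Definition min_period (s : nat -> int) : nat := xget 0%N (minimal_period s).

(* For q = 2p - 1: the word d*_1 ... d*_{q-1} (d*_q - 1) 0, of length q + 1,
   is repeated. *)
Definition char_seq (R : realType) (beta : R) (i : nat) : int :=
  let s := dstar beta in
  let q := min_period s in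
  if odd q then
    let j := (i %% q.+1)%N in
    if (j < q.-1)%N then s j else if j == q.-1 then s q.-1 - 1 else 0
  else s i.

Definition upper_seq (R : realType) (beta : R) (i : nat) : int :=
  if i is j.+1 then char_seq beta j else 0.

HB.instance Definition _ := isPointed.Build int 0.

Notation biseq := (prod_topology (fun _ : int => discrete_topology int)).

Notation borel_biseq := (g_sigma_algebraType (@open biseq)).

Definition shift (x : borel_biseq) : borel_biseq := fun i => x (i + 1).

Definition tail_from (x : borel_biseq) (m : int) (i : nat) : int := x (m + i%:Z).

Definition negbeta_shift (R : realType) (beta : R) : set borel_biseq :=
  [set x | forall m : int,
     alt_le (char_seq beta) (tail_from x m) /\
     alt_le (tail_from x m) (upper_seq beta)].

Definition occurs_at (x : borel_biseq) (m : int) (w : seq int) : Prop :=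
  forall i, (i < size w)%N -> x (m + i%:Z) = nth 0 w i.

Definition language (X : set borel_biseq) : set (seq int) :=
  [set w | exists x m, X x /\ occurs_at x m w].

Definition cylinder (X : set borel_biseq) (w : seq int) : set borel_biseq :=
  [set x | X x /\ occurs_at x 0 w].

Definition intransitive (L : set (seq int)) (t : seq int) : Prop :=
  L t /\ exists2 u, L u & forall a, L a -> ~ L (u ++ a ++ t).

(* Kolmogorov-Sinai entropy. A finite measurable partition is given by the map
   xi sending a point to the index of its cell; since ln 0 = 0, cells of measure
   zero contribute 0. *)
Definition joint_entropy d (T : measurableType d) (R : realType)
    (mu : probability T R) (f : T -> T) (k : nat) (xi : T -> 'I_k) (n : nat) : R :=
  \sum_(w : {ffun 'I_n -> 'I_k})
    let p := fine (mu [set x | forall j : 'I_n, xi (iter j f x) = w j]) in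
    - (p * ln p).

Definition partition_entropy d (T : measurableType d) (R : realType)
    (mu : probability T R) (f : T -> T) (k : nat) (xi : T -> 'I_k) : R :=
  limn (fun n => joint_entropy mu f xi n / n%:R).

Definition ks_entropy d (T : measurableType d) (R : realType)
    (mu : probability T R) (f : T -> T) : \bar R :=
  ereal_sup [set h | exists k (xi : T -> 'I_k),
    (forall c, measurable (xi @^-1` [set c])) /\
    h = (partition_entropy mu f xi)%:E].

(* Borel probability measures on the closed set negbeta_shift beta are the Borel
   probability measures on the full space of two-sided sequences that are carried
   by it. *)
Record max_entropy_measure (R : realType) (beta : R)
    (mu : probability borel_biseq R) : Prop := {
  mem_carried : mu (negbeta_shift beta) = 1%E ;
  mem_invariant : forall A : set borel_biseq,
    measurable A -> mu (shift @^-1` A) = mu A ;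
  mem_entropy : ks_entropy mu shift = (ln `|beta|)%:E
}.

Definition msupport (R : realType) (mu : probability borel_biseq R) :
    set borel_biseq :=
  [set x | forall U : set biseq, open U -> U x -> (0 < mu U)%E].

Definition free_monoid (P : set (seq int)) : set (seq int) :=
  [set w | exists s : seq (seq int),
     (forall v, v \in s -> P v) /\ w = flatten s].

Definition factors (W : set (seq int)) : set (seq int) :=
  [set w | exists u v, W (u ++ w ++ v)].

Definition prefix_code (P : set (seq int)) : Prop :=
  ~ P [::] /\ forall u v, P u -> P v -> prefix u v -> u = v.

Definition suffix_code (P : set (seq int)) : Prop :=
  ~ P [::] /\ forall u v, P u -> P v -> suffix u v -> u = v.

(* #|` fset_set A| is the cardinal of A when A is finite, and 0 otherwise; the
   sets of words of given length over a finite alphabet are finite. *)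
Definition word_count (W : set (seq int)) (n : nat) : nat :=
  #|` fset_set [set w | W w /\ size w = n]|%fset.

Definition conv_radius (R : realType) (a : nat -> R) : \bar R :=
  ereal_sup [set r%:E | r in [set r : R | 0 <= r /\ cvgn (pseries a r)]].

Definition code_radius (R : realType) (P : set (seq int)) : \bar R :=
  conv_radius (fun n => (word_count (free_monoid P) n)%:R : R).

Definition positive_recurrent (R : realType) (P : set (seq int)) : Prop :=
  let rho := code_radius R P in
  (\esum_(x in P) (rho ^+ size x) = 1 /\
   \esum_(x in P) ((size x)%:R%:E * rho ^+ size x) < +oo)%E.

Definition codes_support (R : realType) (mu : probability borel_biseq R)
    (P : set (seq int)) : Prop :=
  language (msupport mu) = factors (free_monoid P).

(* Main.v *)
Require Import Defs.
From mathcomp Require Import all_boot all_order all_algebra.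
From mathcomp Require Import all_classical all_reals all_analysis.
From mathcomp Require Import ring lra zify.

(** Write [s = - beta], [l = beta_l beta], [r = l + 1], so that [beta * r = l],
and let [phi x] be the sum of the [x i * beta ^- i.+1].

For the first claim, a product of code words is a factor of a point [y] of the
support; the points showing this word at the same place form an open
neighbourhood of [y], and invariance moves it to the origin.

For the second claim, the sequences of the shift are those whose tails are
admissible: nonnegative digits, and every tail above the characteristic
sequence.  The alternating order is the order of the values [phi] in [[l, r]]
([alt_lt_phi], [admissible_phi]).  Let [t] be intransitive, [u] a word that
never leads to [t], and suppose that [t] occurs with positive probability.

- Everything leads near [l].  The values of the continuations of [u] contain a
  nondegenerate interval ([perturb]; this is where the modification of the
  characteristic sequence in the odd periodic case matters).  Multiplication by
  [beta] stretches it until it contains a point whose image is [l]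
  ([expand], [reach]).  Hence a passage close enough to [l] can be preceded by
  [u], so it is never followed by [t] ([intransitive_hole]).
- By Poincare recurrence ([recurrent_pr]) a set of points of probability
  [p > 0] sees [t] infinitely often in the future.  All tails of these
  points have values at least [l + e] for some [e > 0].
- Counting words.  The words of length [n] in the shift index branches of an
  expanding map of slope [s], and grow no faster than [T ^ n] for every [T > s]
  ([growth_above]).  The words of the recurrent points index branches of the
  same map with a hole next to [l] cut out: every long interval is
  stretched until it falls partly into the hole, so these words grow no
  faster than [t' ^ n] for some [t' < s] ([growth_below]).
- A Gibbs inequality turns the two counts into the bound
  [p * ln t' + (1 - p) * ln T] for the entropy ([entropy_bound]); when [T] is
  close to [s] this is smaller than [ln s], against maximality.

Arbitrary finite measurable partitions are handled inside the Gibbs inequality,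
by approximating them by partitions read off a window ([approx_partition]). *)

Set Implicit Arguments.
Unset Strict Implicit.
Unset Printing Implicit Defensive.
Import Order.TTheory GRing.Theory Num.Theory.
Import numFieldNormedType.Exports.
Local Open Scope classical_set_scope.
Local Open Scope ring_scope.

(** * Branches of an expanding map with clipped slots *)

Section Counting.
Variables (R : realType) (b lp r : R) (D : nat).
Hypothesis b_lt : b < -1.
Hypothesis lpr : lp < r.
Hypothesis rlp : r <= lp + 1.

Let s := - b.

Definition digits : seq int := [seq i%:Z | i <- iota 0 D.+1].

Fixpoint words (n : nat) : seq (seq int) :=
  if n is n'.+1 then flatten [seq [seq a :: w | w <- words n'] | a <- digits] else [:: [::]].

(** The branch of digit [a] of the map [y |-> b * y - a], clipped to [[lp, r]].
For [lp = beta_l b] these are the branches of the negative beta-transformation;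
a larger [lp] cuts out a hole at the left end point.  Clipping, rather than
discarding, makes the lengths of images additive over adjacent intervals. *)
Definition clip (a : int) (y : R) : R := Num.max lp (Num.min r (b * y - a%:~R)).

(** The branches reverse the orientation, hence the swap. *)
Definition img (J : R * R) (a : int) : R * R := (clip a J.2, clip a J.1).

Definition imgs (J : R * R) (w : seq int) : R * R := foldl img J w.

Definition len (J : R * R) : R := J.2 - J.1.

Definition total_len (k : nat) (J : R * R) : R := \sum_(w <- words k) len (imgs J w).

Definition branches (n : nat) (J : R * R) : R :=
  \sum_(w <- words n) ((imgs J w).1 < (imgs J w).2)%R%:R.

Lemma s_gt1 : 1 < s. Proof. by rewrite /s; have := b_lt; lra. Qed.

Lemma big_wordsS (V : nmodType) (n : nat) (F : seq int -> V) :
  \sum_(w <- words n.+1) F w = \sum_(a <- digits) \sum_(w <- words n) F (a :: w).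
Proof.
rewrite -[words n.+1]/(flatten [seq [seq a :: w | w <- words n] | a <- digits]).
by rewrite big_flatten big_map; apply: eq_bigr => a _; rewrite big_map.
Qed.

Lemma big_words_cat (V : nmodType) (k n : nat) (F : seq int -> V) :
  \sum_(w <- words (k + n)) F w =
  \sum_(u <- words k) \sum_(w <- words n) F (u ++ w).
Proof.
elim: k F => [|k IH] F; first by rewrite add0n big_seq1.
by rewrite addSn !big_wordsS; apply: eq_bigr => a _; rewrite IH.
Qed.

Lemma bM_le (x y : R) : x <= y -> b * y <= b * x.
Proof. by rewrite ler_nM2l //; have := b_lt; lra. Qed.

Lemma bM_lt (x y : R) : x < y -> b * y < b * x.
Proof. by rewrite ltr_nM2l //; have := b_lt; lra. Qed.

Lemma clip_mono (a : int) (x y : R) : x <= y -> clip a y <= clip a x.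
Proof.
move=> xy; have h : b * y - a%:~R <= b * x - a%:~R by rewrite lerD2r bM_le.
rewrite /clip ge_max le_max lexx /= le_max; apply/orP; right.
by rewrite le_min !ge_min lexx h orbT.
Qed.

Lemma clip_bounds (a : int) (x : R) : lp <= clip a x <= r.
Proof. by rewrite /clip le_max lexx /= ge_max ge_min lexx /= ltW. Qed.

Lemma imgs_ord (J : R * R) (w : seq int) : J.1 <= J.2 -> (imgs J w).1 <= (imgs J w).2.
Proof. by elim: w J => //= a w IH J JJ; apply: IH => /=; apply: clip_mono. Qed.

Lemma len_imgs_ge0 (J : R * R) (w : seq int) : J.1 <= J.2 -> 0 <= len (imgs J w).
Proof. by move=> /(imgs_ord w); rewrite /len subr_ge0. Qed.

Lemma len_imgs_add (p m q : R) (w : seq int) :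
  len (imgs (p, q) w) = len (imgs (p, m) w) + len (imgs (m, q) w).
Proof.
elim: w p m q => [|a w IH] p m q; first by rewrite /len /=; ring.
by rewrite /= /img /= (IH _ (clip a m)) addrC.
Qed.

Lemma total_len_add (k : nat) (p m q : R) : total_len k (p, q) = total_len k (p, m) + total_len k (m, q).
Proof. by rewrite /total_len -big_split; apply: eq_bigr => w _; exact: len_imgs_add. Qed.

Lemma total_lenS (k : nat) (J : R * R) : total_len k.+1 J = \sum_(a <- digits) total_len k (img J a).
Proof. by rewrite /total_len big_wordsS. Qed.

Lemma big_digits (V : nmodType) (F : int -> V) :
  \sum_(a <- digits) F a = \sum_(0 <= i < D.+1) F i%:Z.
Proof. by rewrite /digits big_map /index_iota subn0. Qed.

(** The four positions of [b * x] relative to the slot [[lp + n, r + n]] of digit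
[n] and to the end [r + n - 1] of the previous slot; all inequalities between
clipped branches are linear in each of them. *)
Lemma clip_cases (n : nat) (x : R) :
  let z := b * x in let m := Num.min z in
  [\/ [/\ z <= r + n%:R - 1, clip n x = lp,
          m (r + n%:R - 1) = z & m (r + n.+1%:R - 1) = z],
      [/\ r + n%:R - 1 <= z <= lp + n%:R, clip n x = lp,
          m (r + n%:R - 1) = r + n%:R - 1 & m (r + n.+1%:R - 1) = z],
      [/\ lp + n%:R <= z <= r + n%:R, clip n x = z - n%:R,
          m (r + n%:R - 1) = r + n%:R - 1 & m (r + n.+1%:R - 1) = z] |
      [/\ r + n%:R <= z, clip n x = r,
          m (r + n%:R - 1) = r + n%:R - 1 & m (r + n.+1%:R - 1) = r + n%:R]].
Proof.
move=> z m; have h := rlp; have h' := lpr; rewrite /m /clip -/z -natr1 -pmulrn {m}.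
have [z1|z1] := leP z (r + n%:R - 1).
  apply: Or41; split=> //.
    by rewrite max_l // ge_min; apply/orP; right; lra.
  by rewrite min_l //; lra.
have [z2|z2] := leP z (lp + n%:R).
  apply: Or42; split=> //.
  - by lra.
  - by rewrite max_l // ge_min; apply/orP; right; lra.
  - by rewrite min_l //; lra.
have [z3|z3] := leP z (r + n%:R).
  apply: Or43; split=> //.
  - by lra.
  - by rewrite min_r; [rewrite max_r //; lra | lra].
  - by rewrite min_l //; lra.
apply: Or44; split=> //.
- by lra.
- by rewrite min_l; [rewrite max_r //; lra | lra].
- by rewrite min_r //; lra.
Qed.

(** The slots do not overlap, so the clipped increments telescope below the
increment of the unclipped map. *)
Lemma clip_sum_min (x y : R) (n : nat) : x <= y ->
  \sum_(0 <= i < n) (clip i x - clip i y) <=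
  Num.min (b * x) (r + n%:R - 1) - Num.min (b * y) (r + n%:R - 1).
Proof.
move=> xy; have h := bM_le xy.
elim: n => [|n IH]; last rewrite big_nat_recr //=.
  rewrite big_nil subr_ge0 le_min ge_min h /=; rewrite ge_min lexx orbT //.
move: IH; set S := \sum_(_ <= _ < _) _; have := lpr; have := rlp.
by case: (clip_cases n x) => -[+ -> -> ->]; case: (clip_cases n y) => -[+ -> -> ->]; lra.
Qed.

(** If nothing is lost although the slots leave gaps, the image avoids the gaps,
and being an interval it lies in one slot. *)
Lemma clip_sum_eq (x y : R) (n : nat) : r < lp + 1 -> x < y ->
  \sum_(0 <= i < n) (clip i x - clip i y) = - b * (y - x) ->
  exists2 i, (i < n)%N & clip i x - clip i y = - b * (y - x).
Proof.
move=> rlt xy; have h := bM_lt xy; have l := lpr.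
elim: n => [|n IH]; first by rewrite big_nil => e; exfalso; lra.
rewrite big_nat_recr //= => e.
have S0 : \sum_(0 <= i < n) (clip i x - clip i y) >= 0.
  by apply: sumr_ge0 => i _; rewrite subr_ge0 clip_mono // ltW.
have := clip_sum_min n (ltW xy).
move: S0 e IH; set S := \sum_(_ <= _ < _) _ => S0 e IH le.
suff [E|E] : S = - b * (y - x) \/ clip n x - clip n y = - b * (y - x).
- by have [i ii ei] := IH E; exists i => //; exact: ltnW.
- by exists n.
move: e le; case: (clip_cases n x) => -[z1 -> -> _]; case: (clip_cases n y) => -[z2 -> -> _] e le;
  by [left; lra | right; lra | exfalso; lra].
Qed.

Lemma total_len1_le (J : R * R) : J.1 <= J.2 ->
  \sum_(a <- digits) len (img J a) <= s * len J.
Proof.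
move=> JJ; rewrite big_digits; apply: (le_trans (clip_sum_min _ JJ)).
have h := bM_le JJ.
rewrite /s /len.
by case: (clip_cases D.+1 J.1) => -[+ _ -> _]; case: (clip_cases D.+1 J.2) => -[+ _ -> _];
  have := rlp; have := lpr; lra.
Qed.

Lemma total_len_le (k : nat) (J : R * R) : J.1 <= J.2 -> total_len k J <= s ^+ k * len J.
Proof.
elim: k J => [|k IH] J JJ; first by rewrite /total_len big_seq1 mul1r.
rewrite total_lenS exprS mulrAC; apply: (@le_trans _ _ (\sum_(a <- digits) s ^+ k * len (img J a))).
  by apply: ler_sum => a _; apply: IH; exact: clip_mono.
rewrite -mulr_sumr [leRHS]mulrC; apply: ler_wpM2l; last exact: total_len1_le.
by apply: exprn_ge0; apply: ltW; apply: lt_trans s_gt1.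
Qed.

(** As long as nothing is lost, the interval is stretched inside one slot at each
step; slots have length at most 1, so this stops. *)
Lemma total_len_lt (k : nat) (J : R * R) : r < lp + 1 -> lp <= J.1 -> J.2 <= r ->
  1 < s ^+ k * len J -> total_len k J < s ^+ k * len J.
Proof.
move=> rlt; elim: k J => [|k IH] J J1 J2.
  by rewrite mul1r /len => h; exfalso; have := b_lt; have := rlp; lra.
rewrite exprS => h; have s1 := s_gt1.
have sk : 0 < s ^+ k by apply: exprn_gt0; lra.
have JJ : J.1 < J.2.
  rewrite -subr_gt0 -/(len J); apply: contraTT h; rewrite -!leNgt => h.
  by apply: (@le_trans _ _ 0) => //; apply: mulr_ge0_le0 => //; apply: mulr_ge0; lra.
have le0 (a : int) : total_len k (img J a) <= s ^+ k * len (img J a).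
  by apply: total_len_le; apply: clip_mono; exact: ltW.
have [eq|ne] := eqVneq (\sum_(a <- digits) len (img J a)) (s * len J); last first.
  rewrite total_lenS; apply: (@le_lt_trans _ _ (\sum_(a <- digits) s ^+ k * len (img J a))).
    by apply: ler_sum => a _.
  by rewrite -mulr_sumr -mulrA mulrCA ltr_pM2l // lt_neqAle ne total_len1_le // ltW.
move: eq; rewrite big_digits => eq.
have [i iD ei] := clip_sum_eq rlt JJ eq.
have ki : total_len k (img J i) < s ^+ k * len (img J i).
  apply: IH => /=; [by have /andP[] := clip_bounds i J.2 | by have /andP[] := clip_bounds i J.1 |].
  by rewrite /len /= ei mulrA [_ * - b]mulrC.
rewrite total_lenS big_digits (mulrC s) -mulrA -eq mulr_sumr.
rewrite !big_mkord (bigD1 (Ordinal iD)) //= [ltRHS](bigD1 (Ordinal iD)) //=.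
by apply: ltr_leD => //; apply: ler_sum.
Qed.

(** [y] lies in the open domain of the composed branch [w]. *)
Fixpoint follows (w : seq int) (y : R) : bool :=
  if w is a :: w' then (lp < b * y - a%:~R < r) && follows w' (b * y - a%:~R) else true.

Lemma sum_slot_le1 (z : R) (n : nat) :
  \sum_(0 <= i < n) (lp < z - (i%:Z)%:~R < r)%R%:R <= 1 :> R.
Proof.
elim: n => [|n IH]; first by rewrite big_nil.
rewrite big_nat_recr //=; case: (boolP (lp < z - n%:~R < r)) => [h|_]; last by rewrite addr0.
rewrite big_nat big1 ?add0r // => i /andP[_ iin].
have : i.+1%:R <= n%:R :> R by rewrite ler_nat.
move: h; rewrite -pmulrn -natr1 => /andP[h1 h2] le; rewrite -pmulrn.
case: (boolP (lp < z - i%:R < r)) => // /andP[h3 h4]; exfalso; have := rlp; lra.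
Qed.

Lemma sum_follows_le1 (y : R) (n : nat) : \sum_(w <- words n) (follows w y)%:R <= 1 :> R.
Proof.
elim: n y => [|n IH] y; first by rewrite big_seq1.
rewrite big_wordsS; apply: le_trans (sum_slot_le1 (b * y) D.+1).
rewrite big_digits; apply: ler_sum => i _ /=.
by case: (lp < _ < r); [exact: IH | rewrite big1].
Qed.

Lemma follows_nondeg (J : R * R) (w : seq int) (y : R) :
  J.1 < y < J.2 -> follows w y -> (imgs J w).1 < (imgs J w).2.
Proof.
elim: w J y => [|a w IH] J y /=; first by move=> /andP[/lt_trans h /h].
move=> /andP[y1 y2] /andP[/andP[h1 h2]]; apply: IH => /=.
rewrite /clip gt_max lt_max lt_min gt_min h1 h2 !ltrD2r.
by rewrite (bM_lt y1) (bM_lt y2) !orbT.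
Qed.

Lemma imgs_deg (p : R) (w : seq int) : (imgs (p, p) w).1 = (imgs (p, p) w).2.
Proof. by elim: w p => //= a w IH p; rewrite /img /=. Qed.

Variant clip_spec (a : int) (y : R) : R -> Prop :=
| ClipLow of b * y - a%:~R <= lp : clip_spec a y lp
| ClipMid of lp < b * y - a%:~R < r : clip_spec a y (b * y - a%:~R)
| ClipHigh of r <= b * y - a%:~R : clip_spec a y r.

Lemma clipP (a : int) (y : R) : clip_spec a y (clip a y).
Proof.
rewrite /clip; have l := lpr; case: (leP r (b * y - a%:~R)) => h.
  by rewrite max_r ?ltW //; exact: ClipHigh.
by case: (leP (b * y - a%:~R) lp) => h'; [exact: ClipLow | apply: ClipMid; rewrite h'].
Qed.

(** Shrinking an interval changes an image only at the images of its end points,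
and only when these end points lie in the domain of the branch. *)
Lemma imgs_full (p0 p q q0 : R) (w : seq int) :
  p0 <= p -> p <= q -> q <= q0 ->
  p = p0 \/ ~~ follows w p -> q = q0 \/ ~~ follows w q ->
  (imgs (p, q) w).1 < (imgs (p, q) w).2 -> imgs (p, q) w = imgs (p0, q0) w.
Proof.
elim: w p0 p q q0 => [|a w IH] p0 p q q0 p0p pq qq0; first by case=> // ->; case=> // ->.
rewrite [imgs (p, q) _]/(imgs (clip a q, clip a p) w) => hp hq nd.
have lt : clip a q < clip a p.
  rewrite lt_neqAle clip_mono // andbT; apply: contraTneq nd => ->.
  by rewrite imgs_deg ltxx.
have /andP[q0lo _] := clip_bounds a q0; have /andP[_ p0hi] := clip_bounds a p0.
have mq := clip_mono a qq0; have mp := clip_mono a p0p.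
apply: (IH (clip a q0) _ _ (clip a p0)) => //; first exact: ltW.
- have [e|ne] := eqVneq q q0; first by left; rewrite e.
  case: hq => [/eqP|]; first by rewrite (negbTE ne).
  move: lt mq; case: (clipP a q) => /= h lt mq hq.
  + by left; apply/eqP; rewrite eq_le q0lo mq.
  + by right; move: hq; rewrite h.
  + by have /andP[_] := clip_bounds a p; rewrite leNgt lt.
- have [e|ne] := eqVneq p p0; first by left; rewrite e.
  case: hp => [/eqP|]; first by rewrite (negbTE ne).
  move: lt mp; case: (clipP a p) => /= h lt mp hp.
  + by have /andP[] := clip_bounds a q; rewrite leNgt lt.
  + by right; move: hp; rewrite h.
  + by left; apply/eqP; rewrite eq_le p0hi mp.
Qed.

Lemma seq_gap (T : eqType) (f : T -> R) (t : seq T) :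
  exists2 g, 0 < g & forall x, x \in t -> 0 < f x -> g <= f x.
Proof.
elim: t => [|x t [g g0 IH]]; first by exists 1.
have [fx|fx] := ltP 0 (f x); last first.
  by exists g => // y; rewrite inE => /orP[/eqP -> /lt_geF|/IH //]; rewrite fx.
exists (Num.min g (f x)) => [|y]; first by rewrite lt_min g0.
rewrite inE => /orP[/eqP ->|/IH h /h]; first by rewrite ge_min lexx orbT.
by move=> ?; rewrite ge_min; apply/orP; left.
Qed.

(** At most one domain contains each end point of [J]; every other branch that
meets [J] has its full image, of length at least [g], and these lengths
add up to at most [s ^+ k * len J]. *)
Lemma branches_le (k : nat) :
  exists2 g, 0 < g & forall J, lp <= J.1 -> J.1 <= J.2 -> J.2 <= r ->
    branches k J <= 2 + s ^+ k * len J / g.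
Proof.
have [g g0 hg] := seq_gap (fun w => len (imgs (lp, r) w)) (words k).
exists g => // -[p q] /= lop pq qr.
apply: (@le_trans _ _ (\sum_(w <- words k)
  ((follows w p)%:R + (follows w q)%:R + len (imgs (p, q) w) / g))); last first.
  rewrite !big_split /= -mulr_suml; apply: lerD.
    by apply: lerD; exact: sum_follows_le1.
  by rewrite ler_pM2r ?invr_gt0 //; exact: (@total_len_le k (p, q)).
rewrite /branches !big_seq; apply: ler_sum => w wk.
have l0 : 0 <= len (imgs (p, q) w) / g.
  by rewrite divr_ge0 ?(ltW g0) ?len_imgs_ge0.
case: (boolP (_ < _)) => [nd|_]; last by do ?[apply: addr_ge0 => //]; rewrite ler0n.
case ip: (follows w p); first by rewrite -addrA lerDl addr_ge0 // ler0n.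
case iq: (follows w q); first by rewrite add0r lerDl.
have e : imgs (p, q) w = imgs (lp, r) w.
  by apply: imgs_full => //; right; rewrite ?ip ?iq.
by rewrite !add0r ler_pdivlMr // mul1r e; apply: hg => //; rewrite /len subr_gt0 -e.
Qed.

Lemma branches_cat (k n : nat) (J : R * R) :
  branches (k + n) J = \sum_(u <- words k) branches n (imgs J u).
Proof.
rewrite /branches big_words_cat; apply: eq_bigr => u _; apply: eq_bigr => w _.
by rewrite /imgs foldl_cat.
Qed.

Lemma branches_deg (n : nat) (J : R * R) : J.2 <= J.1 -> J.1 <= J.2 -> branches n J = 0.
Proof.
case: J => p q /= qp pq; have -> : p = q by apply/eqP; rewrite eq_le pq.
by rewrite /branches big1 // => w _; rewrite imgs_deg ltxx.
Qed.

Lemma imgs_in (J : R * R) (w : seq int) :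
  lp <= J.1 -> J.2 <= r -> lp <= (imgs J w).1 /\ (imgs J w).2 <= r.
Proof.
elim: w J => //= a w IH J _ _.
by apply: IH => /=; [have /andP[] := clip_bounds a J.2 | have /andP[] := clip_bounds a J.1].
Qed.

Lemma size_words (n : nat) : size (words n) = (D.+1 ^ n)%N.
Proof.
elim: n => // n IH; rewrite expnS -IH.
rewrite -[words n.+1]/[seq a :: w | a <- digits, w <- words n].
by rewrite size_allpairs size_map size_iota.
Qed.

Lemma branches_triv (n : nat) (J : R * R) : branches n J <= (D.+1 ^ n)%:R.
Proof.
apply: (@le_trans _ _ (\sum_(w <- words n) 1)).
  by apply: ler_sum => w _; case: (_ < _).
by rewrite big_const_seq count_predT size_words iter_addr addr0.
Qed.

(** Induction on the number of steps for the bound [c * t ^+ n * (len J + e)]: the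
additive [e] is what pays for the intervals that are too short to count by
their lengths. *)
Lemma growth (t e : R) (M : nat) : 1 <= t -> 0 < e ->
  (forall J, lp <= J.1 -> J.1 < J.2 -> J.2 <= r ->
    exists m, [/\ (0 < m)%N, (m <= M)%N &
      total_len m J + e * branches m J <= t ^+ m * (len J + e)]) ->
  exists2 C, 1 <= C & forall n, branches n (lp, r) <= C * t ^+ n.
Proof.
move=> t1 e0 H; have t0 : 0 < t by exact: lt_le_trans t1.
(* Chosen so that the trivial bound settles the first [M] values of [n]. *)
have [c cE] : exists c : R, c = (D.+1 ^ M)%:R / e by eexists.
have c0 : 0 < c by rewrite cE divr_gt0 // ltr0n expn_gt0.
have main n J : lp <= J.1 -> J.1 <= J.2 -> J.2 <= r -> 
    branches n J <= c * t ^+ n * (len J + e * (J.1 < J.2)%R%:R).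
  elim/ltn_ind: n J => n IH J J1 J12 J2.
  have [d|nd] := leP J.2 J.1.
    by rewrite branches_deg // mulr0 addr0 mulr_ge0 // ?subr_ge0 // mulr_ge0 ?exprn_ge0 // ltW.
  rewrite mulr1; have l0 : 0 <= len J by rewrite subr_ge0.
  have [nM|Mn] := ltnP n M.
    apply: (@le_trans _ _ (D.+1 ^ M)%:R).
      by apply: (le_trans (branches_triv n J)); rewrite ler_nat leq_pexp2l // ltnW.
    rewrite -[leLHS](divfK (lt0r_neq0 e0)) -cE -mulrA ler_pM2l //.
    by rewrite -[leLHS]mul1r; apply: ler_pM; rewrite ?ler01 ?(ltW e0) ?exprn_ege1 ?lerDr.
  have [m [m0 mM Hm]] := H J J1 nd J2.
  have mn : (m <= n)%N by exact: leq_trans Mn.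
  rewrite -(subnKC mn) branches_cat.
  apply: (@le_trans _ _ (\sum_(u <- words m) c * t ^+ (n - m) *
      (len (imgs J u) + e * ((imgs J u).1 < (imgs J u).2)%R%:R))).
    apply: ler_sum => u _; have [? ?] := imgs_in u J1 J2.
    by apply: IH => //; [rewrite ltn_subrL m0 (leq_trans m0) | exact: imgs_ord].
  rewrite -mulr_sumr big_split /= -mulr_sumr -/(total_len m J) -/(branches m J).
  by rewrite exprD [t ^+ m * _]mulrC -!mulrA ler_pM2l // ler_pM2l; [exact: Hm | exact: exprn_gt0].
exists (1 + c * (r - lp + e)) => [|n].
  rewrite lerDl; apply: mulr_ge0; first exact: ltW.
  by apply: addr_ge0; [rewrite subr_ge0; exact: ltW lpr | exact: ltW].
apply: (le_trans (main n (lp, r) _ _ _)) => //=; first exact: ltW lpr.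
rewrite lpr mulr1 /len /= mulrDl mul1r mulrAC lerDr.
by rewrite exprn_ge0 // ltW.
Qed.

Lemma bernoulli (x : R) (n : nat) : -1 <= x -> 1 + n%:R * x <= (1 + x) ^+ n.
Proof.
move=> x1; elim: n => [|n IH]; first by rewrite mul0r addr0 expr0.
rewrite exprS; apply: (@le_trans _ _ ((1 + x) * (1 + n%:R * x))); last first.
  by apply: ler_wpM2l => //; lra.
rewrite -natr1; have : 0 <= n%:R * x ^+ 2 by rewrite mulr_ge0 ?sqr_ge0 // ler0n.
lra.
Qed.

Lemma expr_large (A x : R) : 1 < x -> exists2 n, (0 < n)%N & A <= x ^+ n.
Proof.
move=> x1; exists (Num.trunc (A / (x - 1))).+1 => //.
have h := truncnS_gt (A / (x - 1)); rewrite ltr_pdivrMr ?subr_gt0 // in h.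
have x0 : -1 <= x - 1 by lra.
have := bernoulli (Num.trunc (A / (x - 1))).+1 x0.
by have -> : 1 + (x - 1) = x by [ring]; lra.
Qed.

(** Any rate above the slope bounds the number of branches: short intervals are
cut at most twice in [k] steps, and [2 <= t ^+ k] pays for the doubling. *)
Lemma growth_above (t : R) : s < t ->
  exists2 C, 1 <= C & forall n, branches n (lp, r) <= C * t ^+ n.
Proof.
move=> st; have s1 := s_gt1; have t1 : 1 < t by exact: lt_trans st.
have [k k0 tk] := expr_large 2 t1.
have [g g0 hg] := branches_le k.
have sk0 : 0 < s ^+ k by rewrite exprn_gt0 //; lra.
have stk : s ^+ k < t ^+ k by rewrite ltrXn2r -?lt0n //; lra.
have d0 : 0 < (t ^+ k - s ^+ k) * g / s ^+ k.
  by rewrite divr_gt0 // mulr_gt0 // subr_gt0.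
apply: (@growth t _ k (ltW t1) d0) => J J1 J12 J2.
exists k; split=> //; have l0 : 0 <= len J by rewrite subr_ge0 ltW.
set e := (t ^+ k - _) * g / _ in d0 *.
have h1 := hg J J1 (ltW J12) J2; have h2 := total_len_le k (ltW J12).
have h3 : e * branches k J <= e * (2 + s ^+ k * len J / g) by rewrite ler_pM2l.
have h4 : e * (2 + s ^+ k * len J / g) = e * 2 + (t ^+ k - s ^+ k) * len J.
  by rewrite /e; field; rewrite !gt_eqF.
have h5 : e * 2 <= e * t ^+ k by rewrite ler_pM2l.
lra.
Qed.

(** A gap between consecutive slots makes every interval longer than [d] lose a
definite amount after [M] steps: this is strict for each interval, and
a grid of mesh [d / 2] makes it uniform. *)
Lemma uniform_loss (d : R) : r < lp + 1 -> 0 < d ->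
  exists M e, [/\ (0 < M)%N, 0 < e & forall J, lp <= J.1 -> J.2 <= r -> d <= len J ->
    total_len M J <= s ^+ M * (len J - e)].
Proof.
move=> rlt d0; have [M M0 sM] := expr_large (4 / d) s_gt1.
have sM0 : 0 < s ^+ M by apply: lt_le_trans sM; exact: divr_gt0.
pose x i := lp + i%:R * (d / 2).
pose f i := if x i.+1 <= r then s ^+ M * (d / 2) - total_len M (x i, x i.+1) else 0.
have f0 i : x i.+1 <= r -> 0 < f i.
  move=> xr; rewrite /f xr subr_gt0.
  have e : len (x i, x i.+1) = d / 2 by rewrite /len /x /= -natr1; ring.
  rewrite -e; apply: total_len_lt => //=.
    by rewrite lerDl mulr_ge0 ?ler0n // divr_ge0 // ltW.
  rewrite e; apply: (@lt_le_trans _ _ (4 / d * (d / 2))).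
    by rewrite mulrACA [4 * _]mulrC; have -> : d * 4 * (d^-1 / 2) = 2; [field; lra | lra].
  by rewrite ler_pM2r // divr_gt0.
(* The loss of [J] is at least the loss of the mesh interval inside [J]. *)
have [g g0 hg] := seq_gap f (iota 0 (Num.trunc ((r - lp) / (d / 2))).+1).
exists M, (g / s ^+ M); split=> //; first by rewrite divr_gt0.
case=> p q /= lop qr; have -> : len (p, q) = q - p by []; move=> dpq.
set i := (Num.trunc ((p - lp) / (d / 2))).+1.
have d2 : 0 < d / 2 by rewrite divr_gt0.
have z0 : 0 <= (p - lp) / (d / 2) by rewrite divr_ge0 ?(ltW d2) // subr_ge0.
have /andP[i1 i2] := truncn_itv z0.
rewrite ler_pdivlMr // in i1; rewrite -/i ltr_pdivrMr // in i2.
have xi1 : x i.+1 = x i + d / 2 by rewrite /x -[i.+1%:R]natr1; ring.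
have /andP[xi xi2] : p <= x i <= p + d / 2.
  have iE : i%:R = (Num.trunc ((p - lp) / (d / 2)))%:R + 1 :> R by rewrite natr1.
  by rewrite /x iE; rewrite iE in i2; apply/andP; split; lra.
have xr : x i.+1 <= r by rewrite xi1; lra.
have fi : g <= f i.
  apply: hg (f0 i xr); rewrite mem_iota /= add0n -(ltr_nat R).
  apply: le_lt_trans (truncnS_gt _); rewrite ler_pdivlMr //.
  by move: xr; rewrite xi1 /x; lra.
move: fi; rewrite /f xr => fi.
rewrite (total_len_add _ _ (x i)) (total_len_add _ (x i) (x i.+1)).
have t1 : total_len M (p, x i) <= s ^+ M * (x i - p) by apply: (@total_len_le M (_, _)) => /=; lra.
have t2 : total_len M (x i.+1, q) <= s ^+ M * (q - x i.+1).
  by apply: (@total_len_le M (_, _)) => /=; rewrite xi1; lra.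
have -> : s ^+ M * (q - p - g / s ^+ M) = s ^+ M * (q - p) - g.
  by field; rewrite gt_eqF.
have -> : s ^+ M * (q - p) = s ^+ M * (x i - p) + s ^+ M * (d / 2) + s ^+ M * (q - x i.+1).
  by rewrite xi1; ring.
lra.
Qed.

(** When the slots leave gaps, the growth rate is smaller than the slope: short
intervals are handled as above, long ones lose a definite amount. *)
Lemma growth_below : r < lp + 1 ->
  exists t, [/\ 1 <= t, t < s & exists2 C, 1 <= C & forall n, branches n (lp, r) <= C * t ^+ n].
Proof.
move=> rlt; have s1 := s_gt1; have s0 : 0 < s by lra.
have [k k0 sk] := expr_large 4 s1.
have sk0 : 0 < s ^+ k by rewrite exprn_gt0.
have [g g0 hg] := branches_le k.
have d0 : 0 < g / s ^+ k by rewrite divr_gt0.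
(* An interval shorter than [d] has at most 3 images after [k] steps. *)
have [d dE] : exists d, d = g / s ^+ k by eexists.
rewrite -dE in d0.
have [M [e [M0 e0 hM]]] := uniform_loss rlt d0.
have sM0 : 0 < s ^+ M by rewrite exprn_gt0.
have P0 : 0 < (D.+1 ^ M)%:R :> R by rewrite ltr0n expn_gt0.
(* The additive constants of all images after [M] steps amount to half of the
   loss [e] of a long interval. *)
have [c cE] : exists c : R, c = s ^+ M * e / (2 * (D.+1 ^ M)%:R) by eexists.
have c0 : 0 < c by rewrite cE divr_gt0 ?mulr_gt0.
(* [1 - h] is the gain over [M] or [k] steps that both cases leave room for, and
   that keeps the rate above 1. *)
have [h [h0 h1 h2 h3]] : exists h, [/\ 0 < h, h <= e / 2, h * (d + c) <= c / 4 & h * s <= s - 1].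
  exists (Num.min (e / 2) (Num.min (c / 4 / (d + c)) ((s - 1) / s))).
  have dc0 : 0 < d + c by rewrite addr_gt0.
  split.
  - by rewrite !lt_min !divr_gt0 // subr_gt0.
  - by rewrite ge_min lexx.
  - by rewrite -ler_pdivlMr // !ge_min lexx orbT.
  - by rewrite -ler_pdivlMr // !ge_min lexx !orbT.
have h1' : h <= 1.
  by rewrite -(ler_pM2r s0) mul1r; lra.
have Mk0 : 0 < (M + k)%:R :> R by rewrite ltr0n addn_gt0 M0.
have Mk1 : 1 <= (M + k)%:R :> R by rewrite ler1n addn_gt0 M0.
have [x xE] : exists x, x = h / (M + k)%:R by eexists.
have x0 : 0 < x by rewrite xE divr_gt0.
have xh : x <= h by rewrite xE ler_pdivrMr // ler_peMr // ltW.
have tn n : (n <= M + k)%N -> s ^+ n * (1 - h) <= (s * (1 - x)) ^+ n.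
  move=> nMk; rewrite exprMn ler_pM2l ?exprn_gt0 //.
  have x1 : -1 <= - x by lra.
  apply: le_trans (bernoulli n x1); rewrite lerD2l mulrN lerN2.
  by rewrite xE mulrCA ler_piMr ?(ltW h0) // ler_pdivrMr // mul1r ler_nat.
have xs : x * s <= h * s by rewrite ler_pM2r.
have xs0 : 0 < x * s by rewrite mulr_gt0.
exists (s * (1 - x)); split; [by rewrite mulrBr mulr1; lra | by rewrite mulrBr mulr1; lra |].
apply: (@growth _ c (M + k)) => //; first by rewrite mulrBr mulr1; lra.
move=> J J1 J12 J2; have l0 : 0 < len J by rewrite subr_gt0.
have l1 : len J <= 1 by rewrite /len; have := rlp; lra.
(* Long intervals lose a definite amount in [M] steps. *)
have [ld|ld] := leP d (len J).
  exists M; split=> //; first exact: leq_addr.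
  have a1 := hM J J1 J2 ld; have a2 := tn M (leq_addr _ _).
  have a3 : c * branches M J <= s ^+ M * (e / 2).
    have -> : s ^+ M * (e / 2) = c * (D.+1 ^ M)%:R by rewrite cE; field; rewrite gt_eqF.
    by rewrite ler_pM2l // branches_triv.
  have lc : 0 <= len J + c by rewrite addr_ge0 // ltW.
  have a4 := ler_wpM2r lc a2; apply: le_trans a4.
  apply: (le_trans (lerD a1 a3)); rewrite -mulrA -mulrDr ler_pM2l //.
  have a5 : h * len J <= h by rewrite ler_piMr // ltW.
  have a6 : h * c <= c by rewrite ler_piMl // ltW.
  by rewrite mulrBl mul1r mulrDr; lra.
(* Short ones triple at most in [k] steps, while [4 <= s ^+ k]. *)
exists k; split=> //; first exact: leq_addl.
have a1 := total_len_le k (ltW J12); have a2 := tn k (leq_addl _ _).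
have a3 : c * branches k J <= c * 3.
  rewrite ler_pM2l //; apply: (le_trans (hg J J1 (ltW J12) J2)).
  have : s ^+ k * len J / g <= 1; last by lra.
  by rewrite ler_pdivrMr // mul1r mulrC -ler_pdivlMr // -dE ltW.
have lc : 0 <= len J + c by rewrite addr_ge0 // ltW.
have a4 := ler_wpM2r lc a2; apply: le_trans a4.
apply: (le_trans (lerD a1 a3)).
have a5 : h * (len J + c) <= c / 4.
  by apply: le_trans h2; rewrite ler_pM2l // lerD2r ltW.
have a6 : s ^+ k * (h * (len J + c)) <= s ^+ k * (c / 4) by rewrite ler_pM2l.
have a7 : c * 4 <= c * s ^+ k by rewrite ler_pM2l.
lra.
Qed.

End Counting.

(** * Digit sequences in a negative base *)

Definition tail (x : nat -> int) (i : nat) : nat -> int := fun j => x (i + j)%N.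

Definition consx (a : int) (x : nat -> int) : nat -> int :=
  fun i => if i is j.+1 then x j else a.

Lemma tail0 x : tail x 0 = x. Proof. by apply: funext => i; rewrite /tail add0n. Qed.

Lemma tail_tail x i j : tail (tail x i) j = tail x (i + j).
Proof. by apply: funext => k; rewrite /tail addnA. Qed.

Lemma tail_cons a x i : tail (consx a x) i.+1 = tail x i.
Proof. by apply: funext => k. Qed.

Lemma first_diff (x y : nat -> int) : x <> y ->
  exists k, (forall i, (i < k)%N -> x i = y i) /\ x k != y k.
Proof.
move=> xy; have ex : exists k, x k != y k.
  apply: contrapT => nex; apply: xy; apply: funext => k; apply/eqP/negPn/negP => h.
  by apply: nex; exists k.
case: (ex_minnP ex) => k kd kmin; exists k; split=> // i ik.
by apply/eqP/negPn/negP => /kmin; rewrite leqNgt ik.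
Qed.

Lemma alt_total (x y : nat -> int) : alt_le x y \/ alt_lt y x.
Proof.
have [->|/first_diff[k [ek dk]]] := pselect (x = y); first by left; right.
have : ((-1) ^+ k.+1 * (x k - y k)) != 0 by rewrite mulf_neq0 ?signr_eq0 // subr_eq0.
rewrite neq_lt => /orP[h|h]; first by left; left; exists k.
right; exists k; split=> [i ik|]; first by rewrite ek.
by rewrite -opprB mulrN oppr_lt0.
Qed.

Section Expansions.
Variables (R : realType) (b : R).
Hypothesis b_lt : b < -1.

Let s := - b.

Let s1 : 1 < s. Proof. by rewrite /s; have := b_lt; lra. Qed.

(** The value of the digit sequence [x] in base [b]. *)
Definition phi (x : nat -> int) : R :=
  limn (series (fun i => (x i)%:~R * b^-1 ^+ i.+1)).

Definition bounded_seq (x : nat -> int) := exists M : R, forall i, `|(x i)%:~R| <= M.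

Let b0 : b != 0. Proof. by apply: ltr0_neq0; have := b_lt; lra. Qed.

Lemma bounded_tail x i : bounded_seq x -> bounded_seq (tail x i).
Proof. by move=> [M hM]; exists M => j; exact: hM. Qed.

Lemma le0_of_exp (e C : R) : (forall n, e * s ^+ n <= C) -> e <= 0.
Proof.
move=> h; rewrite leNgt; apply/negP => e0.
have [n _ hn] := expr_large (C / e + 1) s1.
have := h n; rewrite leNgt => /negP; apply.
apply: (@lt_le_trans _ _ (e * (C / e + 1))); last by rewrite ler_pM2l.
by rewrite mulrDr mulr1 mulrCA divff ?gt_eqF // mulr1 ltrDl.
Qed.

Let z0 : R := `|b^-1|.
Let z0_ge0 : 0 <= z0. Proof. exact: normr_ge0. Qed.

Let z01 : z0 < 1.
Proof.
rewrite /z0 normfV invf_lt1 ?normr_gt0 // ltr0_norm //; have := s1; rewrite /s; lra.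
Qed.

Let u (x : nat -> int) : R ^nat := fun i => (x i)%:~R * b^-1 ^+ i.+1.

Let u_le x M i : (forall i, `|(x i)%:~R| <= M :> R) ->
  `|u x i| <= geometric (M * z0) z0 i.
Proof.
move=> hM; rewrite /u normrM normrX exprS mulrA /geometric /=.
by apply: ler_wpM2r; [exact: exprn_ge0 | exact: ler_wpM2r].
Qed.

Let M_ge0 (x : nat -> int) M : (forall i, `|(x i)%:~R| <= M :> R) -> 0 <= M.
Proof. by move=> /(_ 0%N); exact: le_trans. Qed.

Let u_ncvg x : bounded_seq x -> cvgn [normed series (u x)].
Proof.
move=> [M hM]; have M0 := M_ge0 hM; have hu i := u_le i hM.
apply: (series_le_cvg _ _ hu) => //.
- by move=> n; apply: mulr_ge0; [exact: (mulr_ge0 M0 z0_ge0) | exact: exprn_ge0].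
- by apply: is_cvg_geometric_series; rewrite ger0_norm.
Qed.

Lemma phi_bounded x M : (forall i, `|(x i)%:~R| <= M :> R) ->
  `|phi x| <= M * z0 / (1 - z0).
Proof.
move=> hM; have hc := u_ncvg (ex_intro _ M hM).
have n0 : `|z0| < 1 by rewrite ger0_norm.
apply: (le_trans (lim_series_norm hc)).
rewrite -(cvg_lim _ (@cvg_geometric_series _ (M * z0) _ n0)) //.
apply: lim_series_le => //; first exact: is_cvg_geometric_series.
by move=> n; exact: u_le.
Qed.

Lemma phi_rec x : bounded_seq x -> phi x = ((x 0%N)%:~R + phi (tail x 1)) / b.
Proof.
move=> bx; have c1 := normed_cvg (u_ncvg bx).
have c2 := normed_cvg (u_ncvg (bounded_tail 1 bx)).
apply: (cvg_lim (@Rhausdorff R)).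
rewrite -[X in X @ _ --> _]/(series (u x)) -cvg_shiftS.
have -> : [sequence series (u x) n.+1]_n = (fun n => ((x 0%N)%:~R + series (u (tail x 1)) n) / b).
  apply: funext => n; rewrite /= /series /= big_nat_recl // /u expr1 mulrDl; congr (_ + _).
  by rewrite mulr_suml; apply: eq_bigr => i _; rewrite /tail add1n exprSr mulrA.
by apply: cvgMl; apply: cvgD => //; exact: cvg_cst.
Qed.

Lemma phi_tailS x i : bounded_seq x ->
  phi (tail x i.+1) = b * phi (tail x i) - (x i)%:~R.
Proof.
move=> bx; rewrite (phi_rec (bounded_tail i bx)) tail_tail addn1 /tail addn0.
by rewrite mulrC divfK // addrAC subrr add0r.
Qed.

(** The digits determine a bounded orbit of the expanding map: two such orbits
have a difference that is multiplied by [b] at each step. *)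
Lemma phi_orbit x (Y : nat -> R) (C : R) :
  (forall k, Y k.+1 = b * Y k - (x k)%:~R) -> (forall k, `|Y k| <= C) ->
  bounded_seq x /\ forall k, phi (tail x k) = Y k.
Proof.
move=> YS YC.
have bx : bounded_seq x.
  exists (s * C + C) => k; have -> : (x k)%:~R = b * Y k - Y k.+1 by rewrite YS; ring.
  apply: (le_trans (ler_normB _ _)); apply: lerD => //.
  by rewrite normrM ltr0_norm ?ler_pM2l //; have := s1; rewrite /s; lra.
split=> // k; have [M hM] := bx.
pose E j := phi (tail x (k + j)) - Y (k + j)%N.
have ES j : `|E j| = `|E 0%N| * s ^+ j.
  elim: j => [|j IH]; first by rewrite mulr1.
  have -> : E j.+1 = b * E j by rewrite /E addnS phi_tailS // YS; ring.
  by rewrite normrM IH exprS ltr0_norm -/s; [ring | have := s1; rewrite /s; lra].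
have := @le0_of_exp `|E 0%N| (M * z0 / (1 - z0) + C).
have H : forall n, `|E 0%N| * s ^+ n <= M * z0 / (1 - z0) + C.
  move=> n; rewrite -ES; apply: (le_trans (ler_normB _ _)); apply: lerD => //.
  by apply: phi_bounded => i; exact: hM.
by move=> /(_ H); rewrite normr_le0 /E addn0 subr_eq0 => /eqP.
Qed.

Lemma phi_diff x y k : bounded_seq x -> bounded_seq y ->
  (forall i, (i < k)%N -> x i = y i) ->
  s ^+ k.+1 * (phi x - phi y) = (-1) ^+ k.+1 *
    ((x k - y k)%:~R + (phi (tail x k.+1) - phi (tail y k.+1))).
Proof.
move=> bx by_; have sE : s = b * -1 by rewrite mulrN1.
have gen n : (forall i, (i < n)%N -> x i = y i) ->
    b ^+ n * (phi x - phi y) = phi (tail x n) - phi (tail y n).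
  elim: n => [|n IH] h; first by rewrite mul1r !tail0.
  rewrite exprS -mulrA IH => [|i /ltnW]; last exact: h.
  by rewrite !phi_tailS // h //; ring.
move=> /gen h; rewrite sE exprMn [b ^+ k.+1]exprS.
have -> : b * b ^+ k * (-1) ^+ k.+1 * (phi x - phi y) =
  (-1) ^+ k.+1 * (b * (b ^+ k * (phi x - phi y))) by ring.
by rewrite h !phi_tailS // intrB; congr (_ * _); ring.
Qed.

(** The alternating order is the order of the values: the sign [(-1) ^+ k] is that
of [b ^+ k], and the first different digits contribute at least 1, which
outweighs the values of the tails when these differ by at most [1 + e]. *)
Lemma alt_lt_phi (x y : nat -> int) (e : R) : bounded_seq x -> bounded_seq y -> 0 <= e ->
  alt_lt x y ->
  (forall k, `|phi (tail x k.+1) - phi (tail y k.+1)| <= 1 + e) ->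
  s * (phi x - phi y) <= e.
Proof.
move=> bx by_ e0 [k [ek]]; set t := (_ * _) => t0 hD.
have t1 : t <= -1 by rewrite -ltzD1 ?addNr.
have h := phi_diff bx by_ ek.
have le : s ^+ k.+1 * (phi x - phi y) <= e.
  rewrite h mulrDr.
  have -> : (-1) ^+ k.+1 * (x k - y k)%:~R = t%:~R :> R by rewrite /t rmorphM /= rmorphXn /= rmorphN1.
  have a1 : t%:~R <= -1 :> R by rewrite -(ler_int R) in t1.
  have a2 : (-1) ^+ k.+1 * (phi (tail x k.+1) - phi (tail y k.+1)) <= 1 + e.
    apply: le_trans (hD k); apply: le_trans (ler_norm _) _.
    by rewrite normrM normrX normrN1 expr1n mul1r.
  by rewrite -lerBrDr; lra.
have sk : 1 <= s ^+ k by rewrite exprn_ege1 // ltW.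
have [p0|p0] := leP (phi x - phi y) 0.
  by apply: le_trans e0; rewrite pmulr_rle0 // (lt_trans _ s1).
apply: le_trans le; rewrite exprS -mulrA ler_pM2l; last exact: lt_trans s1.
by rewrite ler_peMl // ltW.
Qed.

(** [d] stands for the characteristic sequence and [p k] for the value of its
[k]-th tail.  The parity conditions hold because a return to [l] after an odd
number of steps is what the modification of periodic sequences removes. *)
Variables (d : nat -> int) (p : nat -> R) (l r : R).
Hypothesis rl : r = l + 1.
Hypothesis br : b * r = l.
Hypothesis p0 : p 0%N = l.
Hypothesis pS : forall k, p k.+1 = b * p k - (d k)%:~R.
Hypothesis p_in : forall k, l <= p k <= r.
Hypothesis p_l : forall k, p k = l -> ~~ odd k.
Hypothesis p_r : forall k, p k = r -> odd k.

(** One-sided sequences of the shift.  The upper bound by [0 d] is equivalent to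
the nonnegativity of the first digit together with the lower bound for the tail. *)
Definition admissible (x : nat -> int) := forall i, 0 <= x i /\ alt_le d (tail x i).

Lemma admissible_tail x i : admissible x -> admissible (tail x i).
Proof. by move=> ax j; rewrite tail_tail; exact: ax. Qed.

Lemma admissible_le x i : admissible x -> x i <= d 0%N.
Proof.
move=> /(_ i)[_ [[[|k] [ek]]|->]]; rewrite /tail ?addn0 //.
  by rewrite expr1 mulN1r oppr_lt0 subr_gt0 => /ltW.
by move=> _; rewrite ek // /tail addn0.
Qed.

Lemma admissible_bounded x : admissible x -> forall i, `|(x i)%:~R| <= (d 0%N)%:~R :> R.
Proof.
move=> ax i; have [x0 _] := ax i.
by rewrite ger0_norm ?ler0z // ler_int admissible_le.
Qed.

Let abd x : admissible x -> bounded_seq x.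
Proof. by move=> ax; eexists; exact: admissible_bounded. Qed.

Let p_orbit : bounded_seq d /\ forall k, phi (tail d k) = p k.
Proof.
apply: (@phi_orbit d p (`|l| + 1)) => // k.
have /andP[h1 h2] := p_in k; rewrite rl in h2.
have := ler_norm l; have := ler_norm (- l); rewrite normrN ler_norml => h3 h4.
by apply/andP; split; lra.
Qed.

Let d_bounded := p_orbit.1.
Let phi_d := p_orbit.2.

Let phi_d0 : phi d = l. Proof. by rewrite -[d]tail0 phi_d p0. Qed.

Let l_r : s * r = - l. Proof. by rewrite /s mulNr br. Qed.

(** A lower bound with error [e] gives an upper bound with error [e / s], and then
a lower bound with error [e / s]; iterating removes the error. *)
Lemma admissible_ge_step (e : R) : 0 <= e -> (forall x, admissible x -> l - e <= phi x) ->
  forall x, admissible x -> l - e / s <= phi x /\ phi x <= r + e / s.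
Proof.
move=> e0 h x ax; have s0 : 0 < s by exact: lt_trans s1.
have up y : admissible y -> phi y <= r + e / s.
  move=> ay; rewrite (phi_rec (abd ay)) -(ler_pM2l s0) mulrDr l_r.
  have -> : s * (e / s) = e by rewrite mulrC divfK // gt_eqF.
  have -> : s * (((y 0%N)%:~R + phi (tail y 1)) / b) = - (y 0%N)%:~R - phi (tail y 1).
    by rewrite /s; field.
  have := h _ (admissible_tail 1 ay); have [y0 _] := ay 0%N.
  have : 0 <= (y 0%N)%:~R :> R by rewrite ler0z.
  lra.
split; last exact: up.
have e1 : e / s <= e by rewrite ler_pdivrMr // ler_peMr // ltW.
have [_] := ax 0%N; rewrite tail0 => -[dx|<-]; last first.
  by rewrite -[d]tail0 phi_d p0 lerBlDr lerDl divr_ge0 // ltW.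
have := @alt_lt_phi d x e d_bounded (abd ax) e0 dx.
rewrite phi_d0 => H.
rewrite lerBlDr -lerBlDl -(ler_pM2l s0) mulrC.
have -> : s * (e / s) = e by rewrite mulrC divfK // gt_eqF.
rewrite mulrC; apply: H => k; rewrite phi_d.
have a1 := h _ (admissible_tail k.+1 ax); have a2 := up _ (admissible_tail k.+1 ax).
have /andP[a3 a4] := p_in k.+1.
by move: a2 a4; rewrite rl => a2 a4; rewrite ler_norml; apply/andP; split; lra.
Qed.

Lemma admissible_phi x : admissible x -> l <= phi x <= r.
Proof.
have s0 : 0 < s by exact: lt_trans s1.
set M : R := (d 0%N)%:~R.
have H n : forall y, admissible y -> l - (`|l| + `|M * z0 / (1 - z0)|) / s ^+ n <= phi y.
  elim: n => [|n IH] y ay.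
    have := phi_bounded (admissible_bounded ay).
    rewrite divr1 -/M ler_norml => /andP[h _].
    have := ler_norm l; have := ler_norm (M * z0 / (1 - z0)); lra.
  have e0 : 0 <= (`|l| + `|M * z0 / (1 - z0)|) / s ^+ n.
    by rewrite divr_ge0 ?addr_ge0 // exprn_ge0 // ltW.
  have [h _] := admissible_ge_step e0 IH ay.
  by apply: le_trans h; rewrite exprSr invfM mulrA.
have lo y : admissible y -> l <= phi y.
  move=> ay; rewrite -subr_le0; apply: (@le0_of_exp _ (`|l| + `|M * z0 / (1 - z0)|)) => n.
  have := H n y ay; rewrite lerBlDr -lerBlDl => h.
  by rewrite -ler_pdivlMr // exprn_gt0.
move=> ax; have h0 y : admissible y -> l - 0 <= phi y by rewrite subr0; exact: lo.
by have [] := admissible_ge_step (lexx 0) h0 ax; rewrite mul0r subr0 addr0 => -> ->.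
Qed.

Let dist1 (y z : R) : l <= y <= r -> l <= z <= r -> `|y - z| <= 1 + 0.
Proof.
by rewrite rl => /andP[? ?] /andP[? ?]; rewrite addr0 ler_norml; apply/andP; split; lra.
Qed.

Lemma phi_cons a x : admissible x -> phi (consx a x) = (a%:~R + phi x) / b.
Proof.
move=> ax; rewrite phi_rec ?tail_cons ?tail0 //.
exists (`|a%:~R| + (d 0%N)%:~R) => -[|i] /=.
  by rewrite lerDl; apply: le_trans (admissible_bounded ax 0%N).
by apply: (le_trans (admissible_bounded ax i)); rewrite lerDr.
Qed.

(** A value above [l] excludes that the new sequence is below [d]. *)
Lemma admissible_cons a x : admissible x -> 0 <= a -> l < (a%:~R + phi x) / b -> admissible (consx a x).
Proof.
move=> ax a0 h [|i]; last by rewrite tail_cons; exact: ax i.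
split=> //; rewrite tail0; have [//|lt] := alt_total d (consx a x).
exfalso; move: h; rewrite -(phi_cons a ax) ltNge => /negP; apply.
have bc : bounded_seq (consx a x).
  exists (`|a%:~R| + (d 0%N)%:~R) => -[|i] /=.
    by rewrite lerDl; apply: le_trans (admissible_bounded ax 0%N).
  by apply: (le_trans (admissible_bounded ax i)); rewrite lerDr.
have := alt_lt_phi bc d_bounded (lexx 0) lt.
rewrite phi_d0 pmulr_rle0 ?subr_le0; last exact: lt_trans s1.
apply=> k; rewrite tail_cons phi_d; apply: dist1 => //.
exact/admissible_phi/admissible_tail.
Qed.

(** A second expansion of [l] would differ from [d] at some digit, in front of
tails with the extreme values [l] and [r]; the parity conditions exclude this. *)
Lemma phi_l_eq x : admissible x -> phi x = l -> x = d.
Proof.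
move=> ax xl; have [_] := ax 0%N; rewrite tail0 => -[|//] [k [ek tk]].
exfalso; have := phi_diff d_bounded (abd ax) ek.
rewrite phi_d0 xl subrr mulr0 phi_d.
have /andP[x1 x2] := admissible_phi (admissible_tail k.+1 ax).
have /andP[d1 d2] := p_in k.+1.
move=> /esym/eqP; rewrite mulf_eq0 signr_eq0 /= => /eqP.
move: tk; rewrite -signr_odd; case ok: (odd k.+1); rewrite ?expr1 ?expr0 ?mulN1r ?mul1r.
  rewrite oppr_lt0 gtz0_ge1 -(ler_int R) => t1 e.
  have : p k.+1 = l by move: x2; rewrite rl; lra.
  by move/p_l; rewrite ok.
rewrite -lezD1 -(ler_int R) rmorphD /= => t1 e.
have : p k.+1 = r by move: d2; rewrite rl in x2 *; lra.
by move/p_r; rewrite ok.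
Qed.

Lemma admissible_l_parity x i j : admissible x -> phi (tail x i) = l -> phi (tail x j) = l -> odd i = odd j.
Proof.
move=> ax; wlog ij : i j / (i <= j)%N.
  by move=> h hi hj; case: (leqP i j) => [|/ltnW] /h; [exact | move=> ->].
move=> hi; rewrite -(subnKC ij) -tail_tail (phi_l_eq (admissible_tail i ax) hi) phi_d => /p_l.
by rewrite oddD => /negbTE ->; rewrite addbF.
Qed.

Lemma phi_r_next x i : admissible x -> phi (tail x i) = r -> phi (tail x i.+1) = l.
Proof.
move=> ax xr; have := admissible_phi (admissible_tail i.+1 ax).
rewrite (phi_tailS _ (abd ax)) xr br => /andP[h _].
have [x0 _] := ax i; have : 0 <= (x i)%:~R :> R by rewrite ler0z.
by move=> ?; apply/eqP; rewrite eq_le h andbT; lra.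
Qed.

Lemma uniform_upto (P : nat -> R -> Prop) (n : nat) :
  (forall i, exists2 g, 0 < g & forall h, 0 < h < g -> P i h) ->
  exists2 g, 0 < g & forall h, 0 < h < g -> forall i, (i <= n)%N -> P i h.
Proof.
move=> HP; elim: n => [|n [g g0 hg]].
  by have [g g0 hg] := HP 0%N; exists g => // h hh i; rewrite leqn0 => /eqP ->; exact: hg.
have [g' g'0 hg'] := HP n.+1; exists (Num.min g g'); first by rewrite lt_min g0.
move=> h; rewrite lt_min => /and3P[h0 hl hr] i; rewrite leq_eqVlt ltnS => /orP[/eqP ->|].
  by apply: hg'; rewrite h0.
by apply: hg; rewrite h0.
Qed.

(** All tails of an admissible sequence can be moved into the open interval at
once: visits to an end point prescribe the sign [e] of the perturbation of the
initial value, and by parity they all prescribe the same one. *)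
Lemma perturb x : admissible x -> exists2 e : R, `|e| = 1 & forall n rho, 0 < rho ->
  exists2 g, 0 < g & forall h, 0 < h < g -> forall i, (i <= n)%N ->
    l < phi (tail x i) + e * h * b ^+ i < r /\ `|h * b ^+ i| < rho.
Proof.
move=> ax.
have [e e1 he] : exists2 e : R, `|e| = 1 & forall i,
    (phi (tail x i) = l -> 0 < e * b ^+ i) /\ (phi (tail x i) = r -> e * b ^+ i < 0).
  have bE i : b ^+ i = (-1) ^+ odd i * s ^+ i by rewrite signr_odd -exprMn mulN1r /s opprK.
  have sp i : 0 < s ^+ i by rewrite exprn_gt0 // (lt_trans _ s1).
  have [[i0 hi0]|no] := pselect (exists i, phi (tail x i) = l).
    exists ((-1) ^+ odd i0); first by rewrite normrX normrN1 expr1n.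
    move=> i; rewrite bE mulrA -signr_addb; split => hi.
      by rewrite (admissible_l_parity ax hi0 hi) addbb mul1r.
    rewrite (admissible_l_parity ax hi0 (phi_r_next ax hi)) /=.
    by case: (odd i); rewrite /= expr1 mulN1r oppr_lt0.
  exists 1; first by rewrite normr1.
  by move=> i; split=> h; exfalso; apply: no; [exists i | exists i.+1; exact: phi_r_next].
exists e => // n rho rho0; apply: uniform_upto => i.
have sp : 0 < s ^+ i by rewrite exprn_gt0 // (lt_trans _ s1).
have bs : `|b ^+ i| = s ^+ i by rewrite normrX ltr0_norm //; have := b_lt; lra.
have [hl hr] := he i; have /andP[xl xr] := admissible_phi (admissible_tail i ax).
have cs : `|e * b ^+ i| = s ^+ i by rewrite normrM e1 mul1r bs.
set c := e * b ^+ i in hl hr cs; set y := phi (tail x i) in hl hr xl xr *.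
have [g g0 hg] : exists2 g, 0 < g & forall h, 0 < h < g -> l < y + h * c < r.
  have H h g : 0 < h < g / s ^+ i -> h * `|c| < g.
    by move=> /andP[_]; rewrite cs ltr_pdivlMr.
  have [yl|yl] := eqVneq y l.
    exists (1 / s ^+ i); first exact: divr_gt0.
    have c0 := hl yl; move=> h hh; have := H _ _ hh; rewrite (gtr0_norm c0).
    have : 0 < h * c by rewrite mulr_gt0 //; case/andP: hh.
    by move=> ? ?; rewrite yl rl; apply/andP; split; lra.
  have [yr|yr] := eqVneq y r.
    exists (1 / s ^+ i); first exact: divr_gt0.
    have c0 := hr yr; move=> h hh; have := H _ _ hh; rewrite (ltr0_norm c0) mulrN.
    have : h * c < 0 by rewrite pmulr_rlt0 //; case/andP: hh.
    by move=> ? ?; rewrite yr rl; apply/andP; split; lra.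
  exists (Num.min (y - l) (r - y) / s ^+ i).
    by rewrite divr_gt0 // lt_min !subr_gt0 !lt_neqAle xl xr yr eq_sym yl.
  move=> h hh; have := H _ _ hh; rewrite lt_min => /andP[].
  have h0 : 0 < h by case/andP: hh.
  rewrite -{1 2}(gtr0_norm h0) -!normrM !ltr_norml => /andP[? ?] /andP[? ?].
  by apply/andP; split; lra.
exists (Num.min g (rho / s ^+ i)); first by rewrite lt_min g0 divr_gt0.
move=> h; rewrite lt_min => /and3P[h0 hg1 hg2]; split.
  by rewrite mulrAC mulrC; apply: hg; rewrite h0.
by rewrite normrM bs gtr0_norm // -ltr_pdivlMr.
Qed.

Definition wcat (w : seq int) (z : nat -> int) : nat -> int := foldr consx z w.

Lemma wcat_cat w1 w2 z : wcat (w1 ++ w2) z = wcat w1 (wcat w2 z).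
Proof. exact: foldr_cat. Qed.

Lemma mkseq_tail (x : nat -> int) (j n : nat) :
  mkseq (tail x j) n.+1 = x j :: mkseq (tail x j.+1) n.
Proof.
rewrite /mkseq /= {1}/tail addn0 -[1%N]addn0 iotaDl -map_comp; congr (_ :: _).
by apply: eq_map => i; rewrite /= /tail addnA addn1.
Qed.

(** Every interval of values is stretched until it contains a point [y] whose
image is [l]; sequences with value slightly above [l] then have a preimage
close to [y]. *)
Lemma expand (k1 k2 : R) : l <= k1 -> k1 < k2 -> k2 <= r ->
  exists v, exists2 e, 0 < e & forall z, admissible z -> phi z < l + e ->
    admissible (wcat v z) /\ k1 < phi (wcat v z) < k2.
Proof.
have s0 : 0 < s by exact: lt_trans s1.
have b_lt0 : b < 0 by have := b_lt; lra.
move=> lk k12 kr; have [n _] := expr_large (2 / (k2 - k1)) s1.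
rewrite ler_pdivrMr ?subr_gt0 //.
elim: n k1 k2 lk k12 kr => [|n IH] k1 k2 lk k12 kr.
  by rewrite mul1r rl in kr *; move=> h; exfalso; lra.
move=> hn.
have [[y [a [/andP[y1 y2] a0 ya]]]|no] :=
    pselect (exists y a, [/\ k1 < y < k2, 0 <= a & b * y - a%:~R = l]).
  exists [:: a], (s * (y - k1)); first by rewrite mulr_gt0 // subr_gt0.
  move=> z az zs; have /andP[zl _] := admissible_phi az.
  have E : (a%:~R + phi z) / b = y - (phi z - l) / s.
    by rewrite /s -ya; field.
  have d1 : (phi z - l) / s < y - k1 by rewrite ltr_pdivrMr // mulrC; lra.
  have d2 : 0 <= (phi z - l) / s by rewrite divr_ge0 ?subr_ge0 // ltW.
  rewrite /wcat /= phi_cons //; split; last by rewrite E; apply/andP; split; lra.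
  by apply: admissible_cons => //; rewrite E; lra.
(* The digit of the midpoint is the digit of the whole interval. *)
pose m := (k1 + k2) / 2; pose a := Num.floor (b * m - l).
have /andP[a1 a2] := real_floor_itv (num_real (b * m - l)).
rewrite -/a in a1 a2; rewrite rmorphD /= in a2.
have mk : k1 < m < k2 by rewrite /m; apply/andP; split; lra.
have /andP[mk1 mk2] := mk.
have a0 : 0 <= a.
  rewrite /a floor_ge0 subr_ge0 -br ler_nM2l //; apply: le_trans kr; exact: ltW.
have E1 : l <= b * k2 - a%:~R.
  rewrite leNgt; apply/negP => h; apply: no; exists ((l + a%:~R) / b), a; split=> //.
    have e : b * ((l + a%:~R) / b) = l + a%:~R by rewrite mulrC divfK.
    rewrite -(ltr_nM2l b_lt0) -[X in _ && X](ltr_nM2l b_lt0) e.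
    by have : b * m < b * k1 by [rewrite ltr_nM2l]; move=> ?; apply/andP; split; lra.
  by rewrite mulrC divfK // addrK.
have E2 : b * k1 - a%:~R <= r.
  rewrite leNgt; apply/negP => h; apply: no; exists ((l + (a + 1)%:~R) / b), (a + 1); split.
  - have e : b * ((l + (a + 1)%:~R) / b) = l + a%:~R + 1 by rewrite mulrC divfK // rmorphD addrA.
    rewrite -(ltr_nM2l b_lt0) -[X in _ && X](ltr_nM2l b_lt0) e.
    have : b * k2 < b * m by rewrite ltr_nM2l.
    by move: h; rewrite rl => ? ?; apply/andP; split; lra.
  - by rewrite addr_ge0.
  - by rewrite mulrC divfK // addrK.
have lt' : b * k2 - a%:~R < b * k1 - a%:~R by rewrite ltrD2r ltr_nM2l.
have [|v [e e0 hv]] := IH _ _ E1 lt' E2.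
  by apply: le_trans hn _; rewrite exprSr -mulrA ler_pM2l ?exprn_gt0 // /s; lra.
exists (a :: v), e => // z az ze; have [av /andP[v1 v2]] := hv z az ze.
have in_K : k1 < (a%:~R + phi (wcat v z)) / b < k2.
  rewrite ltr_ndivlMr // ltr_ndivrMr // [k1 * b]mulrC [k2 * b]mulrC.
  by apply/andP; split; lra.
rewrite /wcat /= -/(wcat v z) phi_cons //; split=> //.
by apply: admissible_cons => //; case/andP: in_K => + _; exact: le_lt_trans.
Qed.

(** From any word one can go near the left end point, and then continue with any
admissible sequence close enough to it. *)
Lemma reach x m : admissible x -> exists v, exists2 e, 0 < e &
  forall z, admissible z -> phi z < l + e -> admissible (wcat (mkseq x m ++ v) z).
Proof.
move=> ax; have [c c1 hc] := perturb ax.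
have [g g0 hg] := hc m 1 ltr01.
set y := phi (tail x m).
have b_m : b ^+ m != 0 by rewrite expf_neq0.
have cn : c != 0 by rewrite -normr_gt0 c1.
pose k := c * b ^+ m; have kn : k != 0 by rewrite mulf_neq0.
have in_lr h : 0 < h < g -> l < y + h * k < r.
  by move=> /hg /(_ m (leqnn m)) [+ _]; rewrite /k mulrCA mulrA.
have tail_ok z h : admissible z -> 0 < h < g -> phi z = y + h * k -> admissible (wcat (mkseq x m) z).
  move=> az hh hz.
  suff H j i : (i + j = m)%N -> admissible (wcat (mkseq (tail x i) j) z) /\
      phi (wcat (mkseq (tail x i) j) z) = phi (tail x i) + c * h * b ^+ i.
    by have [] := H m 0%N (add0n m); rewrite tail0.
  elim: j i => [|j IH] i; first by rewrite addn0 => ->; rewrite /= hz /k; split=> //; rewrite /y; ring.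
  rewrite addnS -addSn => /[dup] e /IH[aw pw].
  have im : (i <= m)%N by rewrite -e addSn ltnW // ltnS leq_addr.
  have [/andP[pl _] _] := hg h hh i im.
  have E : ((x i)%:~R + phi (wcat (mkseq (tail x i.+1) j) z)) / b =
      phi (tail x i) + c * h * b ^+ i.
    by rewrite pw (phi_tailS _ (abd ax)) exprS; field.
  rewrite mkseq_tail /wcat /= -/(wcat _ z) phi_cons // E; split=> //.
  by apply: admissible_cons => //; [have [] := ax i | rewrite E].
have h2 : 0 < g / 2 < g by apply/andP; split; lra.
have /andP[q1 q2] := in_lr _ h2; have /andP[y1 y2] : l <= y <= r by exact/admissible_phi/admissible_tail.
(* Half of [g] keeps the far end point of the interval inside [[l, r]]. *)
have [k1 [k2 [lk k12 kr hK]]] : exists k1 k2, [/\ l <= k1, k1 < k2, k2 <= r &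
    forall t, k1 < t < k2 -> exists2 h, 0 < h < g & t = y + h * k].
  have sol t : t = y + (t - y) / k * k by rewrite divfK // addrC subrK.
  move: kn; rewrite neq_lt => /orP[k0|k0].
    have gk : g / 2 * k < 0 by rewrite pmulr_rlt0; lra.
    exists (y + g / 2 * k), y; split; try lra.
    move=> t /andP[t1 t2]; exists ((t - y) / k) => //.
    rewrite ltr_ndivlMr // ltr_ndivrMr // mul0r subr_lt0 t2 /=.
    have -> : g * k = g / 2 * k + g / 2 * k by field.
    by lra.
  have gk : 0 < g / 2 * k by rewrite pmulr_rgt0; lra.
  exists y, (y + g / 2 * k); split; try lra.
  move=> t /andP[t1 t2]; exists ((t - y) / k) => //.
  rewrite ltr_pdivlMr // ltr_pdivrMr // mul0r subr_gt0 t1 /=.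
  have -> : g * k = g / 2 * k + g / 2 * k by field.
  by lra.
have [v [e e0 hv]] := expand lk k12 kr.
exists v, e => // z az ze; have [av /hK[h hh hz]] := hv z az ze.
by rewrite wcat_cat; exact: tail_ok hz.
Qed.

Lemma follows_mkseq (lp : R) (n : nat) (x : nat -> int) (Y : nat -> R) :
  (forall i, (i <= n)%N -> lp < Y i < r) ->
  (forall i, Y i.+1 = b * Y i - (x i)%:~R) -> follows b lp r (mkseq x n) (Y 0%N).
Proof.
elim: n x Y => // n IH x Y hY YS.
rewrite -[x]tail0 mkseq_tail /= -YS hY //=.
by apply: (IH _ (fun i => Y i.+1)) => [i im|i]; [exact: hY | exact: YS].
Qed.

Lemma mem_words (D n : nat) (x : nat -> int) :
  (forall i, 0 <= x i <= D%:Z) -> mkseq x n \in words D n.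
Proof.
elim: n x => [|n IH] x hx //.
have -> : mkseq x n.+1 = x 0%N :: mkseq (tail x 1) n by rewrite -mkseq_tail tail0.
rewrite -[words D n.+1]/(flatten [seq [seq a :: w | w <- words D n] | a <- digits D]).
apply/flatten_mapP; exists (x 0%N).
  have := hx 0%N; case: (x 0%N) => // k /andP[_ kD].
  by apply: map_f; rewrite mem_iota /= add0n ltnS -lez_nat.
by apply: map_f; apply: IH => i; exact: hx.
Qed.

Definition live_words (lp : R) (n : nat) : seq (seq int) :=
  [seq w <- words `|d 0%N|%N n | (imgs b lp r (lp, r) w).1 < (imgs b lp r (lp, r) w).2].

Lemma size_live_words (lp : R) (n : nat) :
  (size (live_words lp n))%:R = branches b lp r `|d 0%N|%N n (lp, r).
Proof.
rewrite size_filter /branches -sum1_count natr_sum big_mkcond; apply: eq_bigr => w _.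
by case: (_ < _).
Qed.

(** After a perturbation the values of the tails form an orbit in the open interval
[(lp, r)], so the word is the address of a branch.  When [lp] is not the left
end point the perturbation has to stay below the margin [e]. *)
Lemma survivor_words (lp : R) (x : nat -> int) (n : nat) : l <= lp -> lp < r -> admissible x ->
  lp = l \/ (exists2 e, 0 < e & forall i, lp + e <= phi (tail x i)) ->
  mkseq x n \in live_words lp n.
Proof.
move=> llp lpr ax hlp; rewrite mem_filter; apply/andP; split; last first.
  apply: mem_words => i; have [x0 _] := ax i; rewrite x0 /=.
  by apply: le_trans (admissible_le i ax) _; rewrite abszE ler_norm.
have [c c1 hc] := perturb ax.
have [e e0 he] : exists2 e, 0 < e & lp = l \/ forall i, lp + e <= phi (tail x i).
  by case: hlp => [|[e e0 he]]; [exists 1 => //; left | exists e => //; right].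
have [g g0 hg] := hc n e e0.
have h2 : 0 < g / 2 < g by apply/andP; split; lra.
pose Y i := phi (tail x i) + c * (g / 2) * b ^+ i.
have YS i : Y i.+1 = b * Y i - (x i)%:~R.
  by rewrite /Y (phi_tailS _ (abd ax)) exprS; ring.
have hY i : (i <= n)%N -> lp < Y i < r.
  move=> im; have [/andP[Y1 Y2] Y3] := hg _ h2 i im.
  rewrite Y2 andbT; case: he => [->//|/(_ i) le].
  have : `|c * (g / 2) * b ^+ i| < e by rewrite -mulrA normrM c1 mul1r.
  by rewrite ltr_norml /Y => /andP[? _]; lra.
apply: (@follows_nondeg _ _ _ _ _ _ _ (Y 0%N)) => //; last exact: follows_mkseq.
exact: hY.
Qed.

End Expansions.

(** * The orbit of the characteristic sequence *)

Section CharacteristicSequence.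
Variables (R : realType) (beta : R).
Hypothesis b_lt : beta < -1.

Let l := beta_l beta.
Let r := l + 1.
Let t k := iter k (beta_T beta) l.
Let dst := dstar beta.
Let q := min_period dst.

Lemma beta_rl : beta * (beta_l beta + 1) = beta_l beta.
Proof. by rewrite /beta_l; field; have := b_lt; lra. Qed.

Let tS k : t k.+1 = beta * t k - (dst k)%:~R.
Proof. by rewrite /t iterS. Qed.

Let t_in k : l <= t k < r.
Proof.
case: k => [|k]; first by rewrite lexx /= /r; lra.
rewrite tS; have /andP[] := real_floor_itv (num_real (beta * t k - l)).
rewrite rmorphD /= -[Num.floor _]/(dst k) => h1 h2.
by rewrite /r; apply/andP; split; lra.
Qed.

Let t_l_period k : (0 < k)%N -> t k = l -> period dst k.
Proof.
move=> k0 tk; split=> // i; rewrite /dst /dstar.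
by rewrite iterD -/(t k) tk.
Qed.

Let period_mod m k : minimal_period dst m -> period dst k -> (m %| k)%N.
Proof.
move=> [[m0 pm] mmin] [k0 pk]; rewrite /dvdn -leqn0 leqNgt; apply/negP => h.
have pmul j i : dst (i + j * m)%N = dst i.
  by elim: j => [|j IH]; rewrite ?addn0 // mulSn addnCA addnC pm.
have : period dst (k %% m)%N.
  split=> // i; rewrite -(pmul (k %/ m)%N) -addnA [(k %% m + _)%N]addnC -divn_eq.
  exact: pk.
by move/mmin; rewrite leqNgt ltn_mod m0.
Qed.

Let qP : odd q -> minimal_period dst q.
Proof. by rewrite /q /min_period; case: xgetP. Qed.

(* The orbits of [t m] and of [t 0] have the same digits. *)
Let t_period m : period dst m -> t m = l.
Proof.
move=> [m0 pm].
have tb k : `|t k| <= `|l| + 1.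
  have /andP[h1 /ltW h2] := t_in k; rewrite /r in h2.
  have := ler_norm l; have := ler_norm (- l); rewrite normrN ler_norml => ? ?.
  by apply/andP; split; lra.
have [_ h1] := phi_orbit b_lt tS tb.
have tS' k : t (k.+1 + m)%N = beta * t (k + m)%N - (dst k)%:~R.
  by rewrite addSn tS pm.
have [_ h2] := @phi_orbit _ _ b_lt dst (fun k => t (k + m)%N) _ tS' (fun k => tb _).
by have := h1 0%N; rewrite h2.
Qed.

Let minimal_exists k : period dst k -> exists m, minimal_period dst m.
Proof.
move=> pk; have ex : exists m, `[< period dst m >] by exists k; exact/asboolP.
case: (ex_minnP ex) => m /asboolP pm hm; exists m; split=> // m' pm'.
by apply: hm; exact/asboolP.
Qed.

(** The values of the tails of the characteristic sequence.  In the modified case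
the period gets longer by the inserted zero, in front of which the value
is the right end point instead of a point of the orbit. *)
Definition char_orbit (k : nat) : R :=
  if odd q then (if (k %% q.+1 < q)%N then t (k %% q.+1) else r) else t k.

Lemma char_orbit0 : char_orbit 0 = l.
Proof. by rewrite /char_orbit mod0n; case: ifP => // oq; rewrite odd_gt0. Qed.

Lemma char_orbit_in k : l <= char_orbit k <= r.
Proof.
have tl j : l <= t j <= r by have /andP[-> /ltW] := t_in j.
by rewrite /char_orbit; case: ifP => // _; case: ifP => // _; rewrite lexx /r; lra.
Qed.

Lemma char_orbitS k : char_orbit k.+1 = beta * char_orbit k - (char_seq beta k)%:~R.
Proof.
rewrite /char_orbit /char_seq -/dst -/q; case: ifP => [oq|_]; last exact: tS.
have [qper _] := qP oq; have q0 := odd_gt0 oq.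
have jq : (k %% q.+1 < q.+1)%N by rewrite ltn_mod.
have e : (k.+1 %% q.+1 = if k %% q.+1 == q then 0 else (k %% q.+1).+1)%N.
  rewrite -addn1 -modnDml addn1; case: eqP => [->|ne]; first by rewrite modnn.
  by rewrite modn_small // ltnS ltn_neqAle -ltnS jq andbT; exact/eqP.
rewrite e; move: jq; set j := (k %% q.+1)%N; clearbody j => jq {e}.
have qq : (q.-1 < q)%N by rewrite ltn_predL.
(* The last position of the modified period carries the zero, the one before it
   the lowered digit. *)
have [jlt|gt|->] := ltngtP j q; last 2 first.
- by move: jq; rewrite ltnS leqNgt gt.
- rewrite /= q0 ltnNge (ltnW qq) /= (gtn_eqF qq) subr0.
  by rewrite /r /l beta_rl.
have -> : (j < q.-1)%N = (j.+1 < q)%N by rewrite -[in RHS](prednK q0) ltnS.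
have [j1|qj] := ltnP j.+1 q; first exact: tS.
have jE : j = q.-1 by apply/eqP; rewrite -eqSS prednK // eqn_leq qj jlt.
have tq : t q = l by apply: t_period.
rewrite jE eqxx rmorphB /= opprB addrCA addrC.
by rewrite -[beta * _ - _]tS prednK // tq.
Qed.

(** An odd return to [l] is an odd period of the expansion of [l], hence makes the
minimal period odd; the modified sequence returns with the even period [q.+1]. *)
Lemma char_orbit_l k : char_orbit k = l -> ~~ odd k.
Proof.
rewrite /char_orbit; case: ifPn => [oq|oq tk].
  have [qper qmin] := qP oq.
  case: ifP => [jq|_ rl]; last by exfalso; move: rl; rewrite /r; lra.
  case: (posnP (k %% q.+1)) => [j0 _|j0 /(t_l_period j0)/qmin]; last by rewrite leqNgt jq.
  have : (q.+1 %| k)%N by rewrite /dvdn j0.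
  move=> /dvdnP[m ->]; rewrite oddM /= oq andbF //.
apply/negP => ok; have pk : period dst k by apply: t_l_period => //; exact: odd_gt0.
have [m mm] := minimal_exists pk.
have qmin : minimal_period dst q by rewrite /q /min_period; case: xgetP => // /(_ m).
have /dvdnP[c kE] := period_mod qmin pk.
by move: ok; rewrite kE oddM (negbTE oq) andbF.
Qed.

Lemma char_orbit_r k : char_orbit k = r -> odd k.
Proof.
have tr j : t j <> r by have /andP[_ /lt_eqF/eqP] := t_in j.
rewrite /char_orbit; case: ifP => [oq|_ /tr//]; case: ifP => [_ /tr //|/negbT].
rewrite -leqNgt => qj _.
have jE : (k %% q.+1)%N = q by apply/eqP; rewrite eqn_leq qj andbT -ltnS ltn_mod.
by rewrite (divn_eq k q.+1) jE oddD oddM /= oq andbF.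
Qed.

End CharacteristicSequence.

(** * Windows and measurability *)

Section Topology.

Definition agree (m : nat) (x y : biseq) := forall i : int, (`|i| <= m)%N -> y i = x i.

Lemma agree_nbhs (m : nat) (x : biseq) : nbhs x (agree m x).
Proof.
have coord (i : int) : nbhs x [set y : biseq | y i = x i].
  have := @proj_continuous int (fun _ => discrete_topology int) i x.
  move=> /(_ [set x i]); apply.
  by rewrite /= nbhs_principalE; apply/principal_filterP.
elim: m => [|m IH].
  by apply: filterS (coord 0) => y /= h i; rewrite leqn0 absz_eq0 => /eqP ->.
apply: filterS (filterI IH (filterI (coord m.+1%:Z) (coord (- m.+1%:Z)))).
move=> y [h1 [h2 h3]] i; rewrite leq_eqVlt ltnS => /orP[/eqP e|]; last exact: h1.
by case: (intP i) e => [|k|k] //= e; [rewrite -e in h2 | rewrite -e in h3]. 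
Qed.

Lemma agree_open (A : set biseq) :
  (forall x, A x -> exists m, forall y, agree m x y -> A y) -> open A.
Proof.
move=> h; rewrite openE => x /h[m hm].
exact: filterS (agree_nbhs m x).
Qed.

(** The sets containing a window neighbourhood of [x] form a filter converging to
[x] coordinatewise, hence in the product topology. *)
Lemma open_agree (A : set biseq) (x : biseq) : open A -> A x ->
  exists m, forall y, agree m x y -> A y.
Proof.
move=> oA Ax.
pose F := [set B : set biseq | exists m, agree m x `<=` B].
have FF : Filter F.
  split; first by exists 0%N.
    move=> P Q [m1 h1] [m2 h2]; exists (maxn m1 m2) => y hy; split.
      by apply: h1 => i im; apply: hy; rewrite leq_max im.
    by apply: h2 => i im; apply: hy; rewrite leq_max im orbT.
  by move=> P Q PQ [m h]; exists m => y /h/PQ.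
have Fx : nbhs x `<=` F.
  apply/(@cvg_sup _ _ _ F x) => i B /= [C [[D oD <-] Dx] CB].
  exists `|i|%N => y hy; apply: CB; rewrite /= hy //.
by apply: Fx; exact: open_nbhs_nbhs.
Qed.

Lemma measurable_agree (A : set borel_biseq) :
  (forall x, A x -> exists m, forall y, agree m x y -> A y) -> measurable A.
Proof. by move=> h; apply: sub_sigma_algebra; exact: agree_open. Qed.

Lemma agree_sym m x y : agree m x y -> agree m y x.
Proof. by move=> h i /h. Qed.

Definition window_set (m : nat) (A : set borel_biseq) :=
  forall x y, agree m x y -> A x -> A y.

Lemma window_measurable m A : window_set m A -> measurable A.
Proof. by move=> h; apply: measurable_agree => x Ax; exists m => y /h; apply. Qed.

Lemma shiftn (x : borel_biseq) n (i : int) : iter n Defs.shift x i = x (i + n%:Z).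
Proof.
elim: n i => [|n IH] i; first by rewrite addr0.
by rewrite iterS /Defs.shift IH -addrA -PoszD add1n.
Qed.

Lemma shift_agree m x y : agree m.+1 x y -> agree m (Defs.shift x) (Defs.shift y).
Proof. by move=> h i im; rewrite /Defs.shift h //; lia. Qed.

Lemma measurable_shift : measurable_fun setT (Defs.shift : borel_biseq -> borel_biseq).
Proof.
apply: (@measurability _ _ _ _ setT Defs.shift (@open biseq : set (set borel_biseq))) => //.
move=> _ [B oB <-]; rewrite setTI; apply: sub_sigma_algebra.
apply: agree_open => x /= /(open_agree oB)[m hm].
by exists m.+1 => y /shift_agree/hm.
Qed.

Lemma measurable_shiftn n : measurable_fun setT (iter n Defs.shift : borel_biseq -> borel_biseq).
Proof.
elim: n => [|n IH]; first exact: measurable_id.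
exact: measurableT_comp measurable_shift IH.
Qed.

End Topology.

(** * Real-valued probabilities *)

Section RealProbability.
Context d (T : measurableType d) (R : realType) (mu : probability T R).

Definition pr (A : set T) : R := fine (mu A).

Lemma prE A : measurable A -> mu A = (pr A)%:E.
Proof. by move=> mA; rewrite /pr fineK // fin_num_measure. Qed.

Lemma pr_ge0 A : 0 <= pr A.
Proof. by rewrite fine_ge0. Qed.

Lemma pr_le A B : measurable A -> measurable B -> A `<=` B -> pr A <= pr B.
Proof.
move=> mA mB AB; rewrite -lee_fin -!prE //.
by apply: le_measure; rewrite ?inE.
Qed.

Lemma pr0 : pr set0 = 0. Proof. by rewrite /pr measure0. Qed.

Lemma prT : pr setT = 1. Proof. by rewrite /pr probability_setT. Qed.

Lemma prU A B : measurable A -> measurable B -> pr (A `|` B) <= pr A + pr B.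
Proof.
move=> mA mB; rewrite -lee_fin EFinD -!prE //; last exact: measurableU.
exact: measureU2.
Qed.

Lemma prU_disj A B : measurable A -> measurable B -> [disjoint A & B] ->
  pr (A `|` B) = pr A + pr B.
Proof.
move=> mA mB AB; apply: EFin_inj; rewrite EFinD -!prE //; last exact: measurableU.
by rewrite measureU //; apply/eqP; rewrite -disj_set2E.
Qed.

Lemma pr_le1 A : measurable A -> pr A <= 1.
Proof. by move=> mA; rewrite -prT; exact: pr_le. Qed.

Lemma pr_full A B : measurable A -> measurable B -> pr A = 1 -> pr (A `&` B) = pr B.
Proof.
move=> mA mB A1.
have mC := measurableC mA.
have e : pr (~` A) = 0.
  by apply: EFin_inj; rewrite -prE // probability_setC // prE // A1 -EFinB subrr.
have mAB := measurableI _ _ mA mB; have mCB := measurableI _ _ mC mB.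
have : pr B = pr (A `&` B) + pr (~` A `&` B).
  rewrite -prU_disj //; last first.
    by apply/disj_setPS => x [[Ax _] [nAx _]].
  by rewrite -setIUl setUv setTI.
have : pr (~` A `&` B) = 0.
  by apply/eqP; rewrite eq_le pr_ge0 andbT -e pr_le.
by move=> ->; rewrite addr0.
Qed.

Lemma pr_decreasing (F : nat -> set T) (e : R) : (forall n, measurable (F n)) ->
  (forall n, F n.+1 `<=` F n) -> \bigcap_n F n = set0 -> 0 < e ->
  exists n, pr (F n) < e.
Proof.
move=> mF dF F0 e0.
have hF : {homo F : n m / (n <= m)%N >-> (m <= n)%O}.
  move=> n m nm; rewrite subsetEset; elim: m nm => [|m IH].
    by rewrite leqn0 => /eqP ->.
  by rewrite leq_eqVlt => /orP[/eqP -> //|/IH]; exact: subset_trans.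
have : (mu \o F) x @[x --> \oo] --> mu (\bigcap_n F n).
  apply: nonincreasing_cvg_mu => //; last by rewrite F0.
  by apply: le_lt_trans (probability_le1 mu (mF 0%N)) (ltry _).
rewrite F0 measure0 => /fine_cvgP[_ /cvgr0_norm_lt /(_ e e0)[N _ hN]].
exists N; apply: le_lt_trans (hN N _); [exact: ler_norm | exact: leqnn].
Qed.

Lemma pr_mem (J : eqType) (h : T -> J) (t : seq J) :
  (forall j, measurable (h @^-1` [set j])) -> uniq t ->
  measurable [set x | h x \in t] /\ pr [set x | h x \in t] = \sum_(j <- t) pr (h @^-1` [set j]).
Proof.
move=> mh; elim: t => [_|j t IH] /=.
  by have -> : [set x | h x \in [::]] = set0 by [apply/seteqP; split]; rewrite pr0 big_nil.
move=> /andP[jt /IH[m1 e1]].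
have E : [set x | h x \in j :: t] = h @^-1` [set j] `|` [set x | h x \in t].
  by apply/seteqP; split=> x /=; rewrite inE; [move=> /orP[/eqP|]; [left|right] | move=> [->|->]; rewrite ?eqxx ?orbT].
rewrite E; split; first exact: measurableU.
rewrite prU_disj // ?e1 ?big_cons //.
by apply/disj_setPS => x [/= -> hj]; rewrite hj in jt.
Qed.

(** Change of variables for a finitely valued random variable [h]. *)
Lemma pr_push (J I : finType) (h : T -> J) (f : J -> I) (F : I -> R) :
  (forall j, measurable (h @^-1` [set j])) ->
  \sum_i F i * pr [set x | f (h x) = i] = \sum_j F (f j) * pr (h @^-1` [set j]).
Proof.
move=> mh; rewrite (partition_big f xpredT) //=; apply: eq_bigr => i _.
have [_] := pr_mem mh (filter_uniq (fun j => f j == i) (enum_uniq J)).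
rewrite big_filter big_enum_cond /= => e.
have -> : [set x | f (h x) = i] = [set x | h x \in [seq j <- enum J | f j == i]].
  by apply/seteqP; split=> x /=; rewrite mem_filter mem_enum inE andbT => /eqP.
rewrite e mulr_sumr; apply: eq_big => [j|j /eqP ->] //.
Qed.

Lemma pr_partition (J : finType) (h : T -> J) :
  (forall j, measurable (h @^-1` [set j])) -> \sum_j pr (h @^-1` [set j]) = 1.
Proof.
move=> mh; have := pr_push (fun=> tt) (fun=> 1) mh.
rewrite (big_pred1 tt); last by case.
have -> : [set x | tt = tt] = [set: T] by apply/seteqP.
by rewrite prT mulr1 => ->; apply: eq_bigr => j _; rewrite mul1r.
Qed.

End RealProbability.

(** * Approximation of partitions by windows *)

Section Approximation.
Variables (R : realType) (mu : probability borel_biseq R).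

Definition symdiff (A B : set borel_biseq) := (A `\` B) `|` (B `\` A).

Definition approximable (A : set borel_biseq) := measurable A /\
  forall e : R, 0 < e -> exists m D, window_set m D /\ pr mu (symdiff A D) < e.

Lemma symdiff_measurable A B : measurable A -> measurable B -> measurable (symdiff A B).
Proof. by move=> mA mB; apply: measurableU; exact: measurableD. Qed.

Lemma window_mono m n A : (m <= n)%N -> window_set m A -> window_set n A.
Proof. by move=> mn h x y xy; apply: h => i im; apply: xy; exact: leq_trans mn. Qed.

Lemma approximable_window m A : window_set m A -> approximable A.
Proof.
move=> h; split; first exact: window_measurable h.
move=> e e0; exists m, A; split=> //.
by rewrite /symdiff setDv setU0 pr0.
Qed.

Lemma approximableU A B : approximable A -> approximable B -> approximable (A `|` B).
Proof.
move=> [mA hA] [mB hB]; split; first exact: measurableU.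
move=> e e0; have e2 : 0 < e / 2 by lra.
have [m [D [wD De]]] := hA _ e2; have [n [C [wC Ce]]] := hB _ e2.
exists (maxn m n), (D `|` C); split.
  move=> x y xy [Dx|Cx]; [left|right].
    by apply: (window_mono (leq_maxl m n) wD) Dx.
  by apply: (window_mono (leq_maxr m n) wC) Cx.
have mD := window_measurable wD; have mC := window_measurable wC.
have m1 := symdiff_measurable mA mD; have m2 := symdiff_measurable mB mC.
apply: (@le_lt_trans _ _ (pr mu (symdiff A D `|` symdiff B C))).
  apply: pr_le; [apply: symdiff_measurable; exact: measurableU | exact: measurableU |].
  move=> x [[[Ax|Bx] n1]|[[Dx|Cx] n1]].
  - by left; left; split=> // Dx; apply: n1; left.
  - by right; left; split=> // Cx; apply: n1; right.
  - by left; right; split=> // Ax; apply: n1; left.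
  - by right; right; split=> // Bx; apply: n1; right.
by apply: le_lt_trans (prU _ m1 m2) _; lra.
Qed.

(** By continuity from below a member of the sequence is already close to the union. *)
Lemma approximable_lim (F : nat -> set borel_biseq) :
  (forall n, approximable (F n)) -> (forall n, F n `<=` F n.+1) ->
  approximable (\bigcup_n F n).
Proof.
move=> aF iF; have mF n := (aF n).1.
have mU : measurable (\bigcup_n F n) by exact: bigcup_measurable.
split=> // e e0; have e2 : 0 < e / 2 by lra.
have [||| n hn] := @pr_decreasing _ _ _ mu (fun n => (\bigcup_n F n) `\` F n) (e / 2) _ _ _ e2.
- by move=> n; exact: measurableD.
- by move=> n x [Ux nFx]; split=> // Fx; apply: nFx; exact: iF.
- by apply/seteqP; split=> // x h; have [[n _ Fx] _] := h 0%N I; have [_] := h n I; apply.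
have [m [D [wD De]]] := (aF n).2 _ e2; have mD := window_measurable wD.
exists m, D; split=> //.
have m1 : measurable ((\bigcup_n F n) `\` F n) by exact: measurableD.
have m2 := symdiff_measurable (mF n) mD.
apply: (@le_lt_trans _ _ (pr mu (((\bigcup_n F n) `\` F n) `|` symdiff (F n) D))).
  apply: pr_le; [exact: symdiff_measurable | exact: measurableU |].
  move=> x [[Ux nDx]|[Dx nUx]].
    have [Fx|nFx] := pselect (F n x); first by right; left.
    by left.
  by right; right; split=> // Fx; apply: nUx; exists n.
by apply: le_lt_trans (prU _ m1 m2) _; lra.
Qed.

Lemma measurable_approximable (A : set borel_biseq) : measurable A -> approximable A.
Proof.
suff : <<s @open biseq >> `<=` approximable by apply.
apply: smallest_sub.
  split.
  - by apply: (@approximable_window 0).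
  - move=> {}A [mA hA]; rewrite setTD; split; first exact: measurableC.
    move=> e /hA[m [D [wD De]]]; exists m, (~` D); split.
      by move=> x y xy nDx Dy; apply: nDx; apply: wD Dy; exact: agree_sym.
    suff -> : symdiff (~` A) (~` D) = symdiff A D by [].
    apply/seteqP; split=> x.
      by move=> [[nA /contrapT Dx]|[nD /contrapT Ax]]; [right|left].
    by move=> [[Ax nD]|[Dx nA]]; [right|left]; split.
  - move=> F aF; rewrite -bigcup_bigsetU_bigcup.
    apply: approximable_lim => n.
      elim: n.+1 => [|k IH]; first by rewrite big_ord0; exact: (@approximable_window 0).
      by rewrite big_ord_recr /=; exact: approximableU.
    by move=> x Fx; rewrite big_ord_recr; left.
move=> U oU.
have -> : U = \bigcup_n [set x | agree n x `<=` U].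
  apply/seteqP; split=> x.
    by move=> /(open_agree oU)[m hm]; exists m.
  by move=> [n _ h]; apply: h.
apply: approximable_lim => n.
  apply: (@approximable_window n) => x y xy h z yz; apply: h => i im.
  by rewrite yz // xy.
by move=> x h y xy; apply: h => i im; apply: xy; exact: leqW.
Qed.

(** Approximate each cell by a window set, and send a point to a cell whose window
set contains it: an error forces the point into one of the symmetric differences. *)
Lemma approx_partition (k : nat) (xi : borel_biseq -> 'I_k) (e : R) :
  (forall c, measurable (xi @^-1` [set c])) -> 0 < e ->
  exists m (f : borel_biseq -> 'I_k),
    [/\ forall x y, agree m x y -> f x = f y,
        measurable [set x | xi x != f x] &
        pr mu [set x | xi x != f x] < e].
Proof.
move=> mxi e0; have k0 : (0 < k)%N.
  by have := ltn_ord (xi (fun=> 0)); exact: leq_ltn_trans.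
have e1 : 0 < e / k%:R by rewrite divr_gt0 // ltr0n.
have [m /choice[D hD]] : exists m, forall c, exists D,
    window_set m D /\ pr mu (symdiff (xi @^-1` [set c]) D) < e / k%:R.
  have /choice[g hg] : forall c, exists m, exists D,
    window_set m D /\ pr mu (symdiff (xi @^-1` [set c]) D) < e / k%:R.
    by move=> c; exact: (measurable_approximable (mxi c)).2.
  exists (\max_c g c)%N => c; have [D [wD De]] := hg c.
  by exists D; split=> //; apply: window_mono wD; exact: leq_bigmax.
pose f x := odflt (Ordinal k0) [pick c | `[< D c x >]].
have f_window x y : agree m x y -> f x = f y.
  move=> xy; rewrite /f; congr odflt; apply: eq_pick => c.
  apply: asbool_equiv_eq; split; first exact: (hD c).1.
  by apply: (hD c).1; exact: agree_sym.
have mf c : measurable (f @^-1` [set c]).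
  by apply: (@window_measurable m) => x y xy /= <-; exact/esym/f_window.
have sub : [set x | xi x != f x] `<=` [set x | exists c, symdiff (xi @^-1` [set c]) (D c) x].
  move=> x /= xf; apply: contrapT => no.
  have Dx c : D c x <-> xi x = c.
    split=> [Dx|xc]; apply: contrapT => h; apply: no; exists c.
      by right.
    by left.
  move: xf; rewrite /f; case: pickP => [c /asboolP/Dx ->|]; first by rewrite eqxx.
  by move=> /(_ (xi x)) h; have /asboolP : D (xi x) x by [exact/Dx]; rewrite h.
have mneq : measurable [set x | xi x != f x].
  have -> : [set x | xi x != f x] =
      ~` \bigcup_(c in [set: 'I_k]) ((xi @^-1` [set c]) `&` (f @^-1` [set c])).
    apply/seteqP; split=> x /=.
      by move=> /eqP xf [c _ [/= xc fc]]; apply: xf; rewrite xc fc.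
    by move=> h; apply/eqP => xf; apply: h; exists (xi x).
  apply: measurableC; apply: fin_bigcup_measurable => // c _.
  exact: measurableI.
exists m, f; split=> //.
have [mB pB] : measurable (\big[setU/set0]_(c < k) symdiff (xi @^-1` [set c]) (D c)) /\
   pr mu (\big[setU/set0]_(c < k) symdiff (xi @^-1` [set c]) (D c)) < e.
  have ms c : measurable (symdiff (xi @^-1` [set c]) (D c)).
    by apply: symdiff_measurable => //; exact: window_measurable (hD c).1.
  split; first exact: bigsetU_measurable.
  have le : pr mu (\big[setU/set0]_(c < k) symdiff (xi @^-1` [set c]) (D c)) <=
      \sum_(c < k) pr mu (symdiff (xi @^-1` [set c]) (D c)).
    suff [] : measurable (\big[setU/set0]_(c < k) symdiff (xi @^-1` [set c]) (D c)) /\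
        pr mu (\big[setU/set0]_(c < k) symdiff (xi @^-1` [set c]) (D c)) <=
        \sum_(c < k) pr mu (symdiff (xi @^-1` [set c]) (D c)) by [].
    apply: (big_ind2 (fun A z => measurable A /\ pr mu A <= z)) => [|A a B b [mA Aa] [mB Bb]|c _].
    - by rewrite pr0.
    - by split; [exact: measurableU | exact: le_trans (prU _ mA mB) (lerD Aa Bb)].
    - by split.
  apply: le_lt_trans le _; apply: (@lt_le_trans _ _ (\sum_(c < k) e / k%:R)).
    by apply: ltr_sum => [|c _]; [apply/hasP; exists (Ordinal k0); rewrite ?mem_index_enum | exact: (hD c).2].
  by rewrite sumr_const card_ord -[_ *+ k]mulr_natr divfK // pnatr_eq0 -lt0n.
apply: le_lt_trans pB; apply: pr_le => // x /sub[c hc].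
by rewrite (bigD1 c) //=; left.
Qed.

End Approximation.

(** * An upper bound for the entropy *)

Section GibbsBound.
Variables (R : realType) (mu : probability borel_biseq R).
Hypothesis mu_inv : forall A, measurable A -> mu (Defs.shift @^-1` A) = mu A.

Lemma pr_shiftn n A : measurable A -> pr mu (iter n Defs.shift @^-1` A) = pr mu A.
Proof.
move=> mA; elim: n => // n <-; rewrite /pr -[in RHS]mu_inv.
  congr (fine (mu _)); apply/seteqP; split=> x /=; by rewrite -iterSr.
by rewrite -[X in measurable X]setTI; exact: measurable_shiftn.
Qed.

(** [ln x <= x - 1] at [x = Q / p]. *)
Lemma gibbs_term (p Q : R) : 0 <= p -> 0 < Q -> - (p * ln p) <= p * (- ln Q) + (Q - p).
Proof.
move=> p0 Q0; move: p0; rewrite le_eqVlt => /orP[/eqP <-|p0].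
  by rewrite !mul0r oppr0 add0r addr0 ltW.
have h : ln (Q / p) <= Q / p - 1.
  have := @expR_ge1Dx R (ln (Q / p)); rewrite lnK ?posrE ?divr_gt0 //; lra.
rewrite lnM ?posrE ?invr_gt0 // lnV ?posrE // in h.
have := h; rewrite -(ler_pM2l p0) => h'.
have e : p * (Q / p - 1) = Q - p by field; rewrite gt_eqF.
by rewrite e in h'; lra.
Qed.

Variables (S G : set borel_biseq).
Hypotheses (mS : measurable S) (mG : measurable G) (S1 : pr mu S = 1).

Definition window_word (m n : nat) (x : biseq) : seq int :=
  mkseq (fun i => x (- m%:Z + i%:Z)) n.

(** A point whose coordinates near 0 are those of the [j]-th shift of any point with
window word [w]. *)
Definition decode (m j : nat) (w : seq int) : biseq := fun i => nth 0 w (absz (i + j%:Z + m%:Z)).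

Lemma decodeK (m n j : nat) (x : borel_biseq) : (j < n)%N ->
  agree m (iter j Defs.shift x) (decode m j (window_word m (n + m.*2) x)).
Proof.
move=> jn i im; rewrite shiftn /decode nth_mkseq; last by lia.
by congr (x _); lia.
Qed.

Section FixedLength.
Variables (k n m : nat) (xi f : borel_biseq -> 'I_k) (A B : R).
Hypothesis mxi : forall c, measurable (xi @^-1` [set c]).
Hypothesis f_window : forall x y, agree m x y -> f x = f y.
Hypotheses (A0 : 0 <= A) (AB : expR (- A) + k%:R * expR (- B) <= 1).
Variables (LW VW : seq (seq int)) (L V : R).
Hypotheses (L0 : 0 < L) (V0 : 0 < V) (sL : (size LW)%:R <= L) (sV : (size VW)%:R <= V).
Hypothesis LWP : forall x, S x -> window_word m (n + m.*2) x \in LW.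
Hypothesis VWP : forall x, S x -> G x -> window_word m (n + m.*2) x \in VW.

(* The price of a letter [c] when the window predicts [c']; the condition on [A]
   and [B] says that the resulting weights have total at most 1. *)
Let cost (c c' : 'I_k) : R := A + (c != c')%:R * B.

Let kernel (om : {ffun 'I_n -> 'I_k}) (w : seq int) : R :=
  expR (- \sum_(j < n) cost (om j) (f (decode m j w))).

(* A subprobability on names: pick one of the two lists of words, then a word of
   it, then read the name off the word with random errors. *)
Let Q om : R := 2^-1 * (\sum_(w <- VW) kernel om w / V + \sum_(w <- LW) kernel om w / L).

Let kernel_sum w : \sum_om kernel om w <= 1.
Proof.
have -> : \sum_om kernel om w = \sum_(om : {ffun 'I_n -> 'I_k})
    \prod_(j < n) expR (- cost (om j) (f (decode m j w))).
  by apply: eq_bigr => om _; rewrite /kernel -sumrN expR_sum.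
rewrite -(bigA_distr_bigA (fun (j : 'I_n) c => expR (- cost c (f (decode m j w))))) /=.
suff /andP[_ //] : 0 <= \prod_(j < n) \sum_c expR (- cost c (f (decode m j w))) <= 1.
apply: (big_ind (fun z : R => 0 <= z <= 1)) => [|x y /andP[x0 x1] /andP[y0 y1]|j _].
- by rewrite ler01 lexx.
- by rewrite mulr_ge0 //= mulr_ile1.
apply/andP; split.
  by apply: sumr_ge0 => c _; exact: expR_ge0.
apply: le_trans AB; rewrite (bigD1 (f (decode m j w))) //=.
apply: lerD; first by rewrite /cost eqxx mul0r addr0.
apply: (@le_trans _ _ (\sum_(c < k) expR (- B))).
  rewrite [leRHS](bigD1 (f (decode m j w))) //= -[leLHS]add0r.
  apply: lerD; first exact: expR_ge0.
  apply: ler_sum => c cne; rewrite /cost cne mul1r ler_expR; have := A0; lra.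
by rewrite sumr_const card_ord mulr_natl.
Qed.

Let Q_sum : \sum_om Q om <= 1.
Proof.
have H (W : seq (seq int)) (M : R) : 0 < M -> (size W)%:R <= M ->
    \sum_om \sum_(w <- W) kernel om w / M <= 1.
  move=> M0 sM; rewrite exchange_big /=.
  apply: (@le_trans _ _ (\sum_(w <- W) M^-1)).
    apply: ler_sum => w _; rewrite -mulr_suml ler_piMl ?kernel_sum //.
    by rewrite invr_ge0 ltW.
  by rewrite big_const_seq count_predT iter_addr addr0 -mulr_natl ler_pdivrMr // mul1r.
rewrite -mulr_sumr big_split /=; have := H _ _ V0 sV; have := H _ _ L0 sL; lra.
Qed.

Let kernel_gt0 om w : 0 < kernel om w. Proof. exact: expR_gt0. Qed.

Let sum_ge0 W (M : R) om : 0 < M -> 0 <= \sum_(w <- W) kernel om w / M.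
Proof. by move=> M0; apply: sumr_ge0 => w _; rewrite divr_ge0 // ltW. Qed.

Let Q_ge om w W (M : R) : 0 < M -> w \in W -> (W = LW /\ M = L \/ W = VW /\ M = V) ->
  2^-1 * (kernel om w / M) <= Q om.
Proof.
move=> M0 wW h.
have le : kernel om w / M <= \sum_(w <- W) kernel om w / M.
  rewrite (big_rem w) //= lerDl; apply: sum_ge0 => //.
rewrite ler_pM2l ?invr_gt0 //; apply: (le_trans le).
by case: h => -[-> ->]; rewrite ?lerDl ?lerDr; exact: sum_ge0.
Qed.

Let S_nonempty : exists x, S x.
Proof.
apply: contrapT => h; have : S = set0 by apply/seteqP; split=> // x Sx; apply: h; exists x.
by move=> S0; have := S1; rewrite S0 pr0 => /eqP; rewrite eq_sym oner_eq0.
Qed.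

Let Q_gt0 om : 0 < Q om.
Proof.
have [x Sx] := S_nonempty.
apply: lt_le_trans (Q_ge om L0 (LWP Sx) (or_introl (conj erefl erefl))).
by rewrite mulr_gt0 ?invr_gt0 // divr_gt0.
Qed.

Let neg_ln_Q om w W (M : R) : 0 < M -> w \in W -> (W = LW /\ M = L \/ W = VW /\ M = V) ->
  - ln (Q om) <= ln 2 + ln M + \sum_(j < n) cost (om j) (f (decode m j w)).
Proof.
move=> M0 wW h; have := Q_ge om M0 wW h.
have p0 : 0 < 2^-1 * (kernel om w / M) by rewrite mulr_gt0 ?invr_gt0 // divr_gt0.
rewrite -ler_ln ?posrE // lnM ?posrE ?invr_gt0 ?divr_gt0 //.
rewrite lnM ?posrE ?invr_gt0 // !lnV ?posrE // /kernel expRK; lra.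
Qed.

Let zeta (x : borel_biseq) := (xi x, f x).
Let J := ({ffun 'I_n -> 'I_k * 'I_k} * bool)%type.
(* The joint name under [xi] and [f] determines the errors; the boolean records
   which list of words is available. *)
Let h (x : borel_biseq) : J := ([ffun j : 'I_n => zeta (iter j Defs.shift x)], `[< G x >]).

Let mf c : measurable (f @^-1` [set c]).
Proof. by apply: (@window_measurable m) => x y xy /= <-; exact/esym/f_window. Qed.

Let mh j : measurable (h @^-1` [set j]).
Proof.
case: j => w b.
have -> : h @^-1` [set (w, b)] =
    (\bigcap_(j in [set: 'I_n]) (iter j Defs.shift @^-1`
      (xi @^-1` [set (w j).1] `&` f @^-1` [set (w j).2]))) `&` (if b then G else ~` G).
  apply/seteqP; split=> x /=.
    move=> [<- <-]; split; first by move=> j _; rewrite ffunE.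
    by case: asboolP.
  move=> [h1 h2]; congr pair; last by case: b h2 => h2; apply/asboolP.
  by apply/ffunP => j; rewrite ffunE /zeta; have [-> ->] := h1 j I; case: (w j).
apply: measurableI; last by case: b => //; exact: measurableC.
apply: fin_bigcap_measurable => // j _.
rewrite -[X in measurable X]setTI; apply: measurable_shiftn => //.
exact: measurableI.
Qed.

Let bad := [set x | xi x != f x].
Hypothesis mbad : measurable bad.

(** The entropy of the names is at most their mean code length under [Q], and
[- ln Q] is at most the logarithm of the length of the list plus the cost of the
errors, where points of [G] may use the shorter list. *)
Lemma gibbs_bound :
  joint_entropy mu Defs.shift xi n <=
  ln 2 + (pr mu G * ln V + (1 - pr mu G) * ln L) + n%:R * (A + pr mu bad * B).
Proof.
pose name (j : J) : {ffun 'I_n -> 'I_k} := [ffun i => (j.1 i).1].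
have nameE (om : {ffun 'I_n -> 'I_k}) : [set x | forall j : 'I_n, xi (iter j Defs.shift x) = om j] =
    [set x | name (h x) = om].
  apply/seteqP; split=> x /=.
    by move=> hx; apply/ffunP => j; rewrite !ffunE /= hx.
  by move=> <- j; rewrite !ffunE.
apply: (@le_trans _ _ (\sum_om (pr mu [set x | name (h x) = om] * (- ln (Q om)) +
    (Q om - pr mu [set x | name (h x) = om])))).
  apply: ler_sum => om _ /=; rewrite nameE -/(pr mu _).
  by apply: gibbs_term; [exact: pr_ge0 | exact: Q_gt0].
rewrite big_split /= sumrB.
have tot1 : \sum_om pr mu [set x | name (h x) = om] = 1.
  have := pr_push mu name (fun=> 1) mh.
  under eq_bigr do rewrite mul1r.
  by move=> ->; under eq_bigr do rewrite mul1r; exact: pr_partition.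
have -> : \sum_om pr mu [set x | name (h x) = om] * - ln (Q om) =
    \sum_j (- ln (Q (name j))) * pr mu (h @^-1` [set j]).
  by rewrite -(pr_push mu name (fun om => - ln (Q om)) mh); apply: eq_bigr => om _; rewrite mulrC.
pose c (j : J) : R := ln 2 + (if j.2 then ln V else ln L) +
  \sum_(i < n) (A + ((j.1 i).1 != (j.1 i).2)%:R * B).
have cP j : (- ln (Q (name j))) * pr mu (h @^-1` [set j]) <= c j * pr mu (h @^-1` [set j]).
  have [[x [Sx hx]]|no] := pselect (exists x, S x /\ h x = j); last first.
    have -> : pr mu (h @^-1` [set j]) = 0; last by rewrite !mulr0.
    rewrite -(pr_full mS (mh j) S1) (_ : _ `&` _ = set0) ?pr0 //.
    by apply/seteqP; split=> // x [Sx hx]; apply: no; exists x.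
  apply: ler_wpM2r; first exact: pr_ge0.
  have e : \sum_(i < n) cost (name j i) (f (decode m i (window_word m (n + m.*2) x))) =
      \sum_(i < n) (A + ((j.1 i).1 != (j.1 i).2)%:R * B).
    apply: eq_bigr => i _; rewrite /cost ffunE -hx /= !ffunE /=.
    by rewrite -(f_window (@decodeK m n i x (ltn_ord i))).
  rewrite /c -e -hx /=; case: asboolP => [Gx|_].
    by apply: neg_ln_Q V0 (VWP Sx Gx) _; right.
  by apply: neg_ln_Q L0 (LWP Sx) _; left.
have main : \sum_j (- ln (Q (name j))) * pr mu (h @^-1` [set j]) <=
    \sum_j c j * pr mu (h @^-1` [set j]) by apply: ler_sum => j _; exact: cP.
have cE : \sum_j c j * pr mu (h @^-1` [set j]) =
    ln 2 + (pr mu G * ln V + (1 - pr mu G) * ln L) + n%:R * (A + pr mu bad * B).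
  under eq_bigr do rewrite /c mulrDl mulrDl mulr_suml.
  rewrite !big_split /= -mulr_sumr pr_partition // mulr1; congr (_ + _ + _).
    rewrite -(pr_push mu (fun j : J => j.2) (fun b : bool => if b then ln V else ln L) mh).
    rewrite big_bool /=; congr (_ + _); rewrite mulrC; congr (_ * _).
      by congr (pr mu _); apply/seteqP; split=> x /= /asboolP.
    have -> : [set x | `[< G x >] = false] = ~` G.
      by apply/seteqP; split=> x /=; case: asboolP.
    by apply: EFin_inj; rewrite -prE ?probability_setC ?EFinB ?prE //; exact: measurableC.
  rewrite exchange_big /=.
  have E (i : 'I_n) : \sum_(j : J) (A + ((j.1 i).1 != (j.1 i).2)%:R * B) * pr mu (h @^-1` [set j]) =
      A + pr mu bad * B.
    under eq_bigr do rewrite mulrDl.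
    rewrite big_split /= -mulr_sumr pr_partition // mulr1; congr (_ + _).
    rewrite -(pr_push mu (fun j : J => (j.1 i).1 != (j.1 i).2) (fun b : bool => b%:R * B) mh).
    rewrite big_bool /= !mul0r addr0 mul1r mulrC; congr (_ * _).
    rewrite -(pr_shiftn i mbad); congr (pr mu _).
    by apply/seteqP; split=> x /=; rewrite ffunE.
  by under eq_bigr do rewrite E; rewrite sumr_const card_ord mulr_natl.
move: main; rewrite cE tot1; have := Q_sum; lra.
Qed.

End FixedLength.

(** The approximation of the partition is chosen after the costs: [A] small, then
[B] large, then an error probability small compared with [1 / B]. *)
Lemma entropy_bound (C t t' : R) (LW VW : nat -> seq (seq int)) :
  1 <= C -> 1 <= t -> 1 <= t' ->
  (forall n, (size (LW n))%:R <= C * t ^+ n) -> (forall n, (size (VW n))%:R <= C * t' ^+ n) ->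
  (forall m n x, S x -> window_word m n x \in LW n) ->
  (forall m n x, S x -> G x -> window_word m n x \in VW n) ->
  (ks_entropy mu Defs.shift <= (pr mu G * ln t' + (1 - pr mu G) * ln t)%:E)%E.
Proof.
move=> C1 t1 t'1 sL sV LWP VWP; apply: ge_ereal_sup => _ [k [xi [mxi ->]]].
rewrite lee_fin; set b := (_ + _).
have p0 := pr_ge0 mu G; have p1 := pr_le1 mu mG.
have lt0 := ln_ge0 t1; have lt'0 := ln_ge0 t'1; have lC0 := ln_ge0 C1.
have b0 : 0 <= b by rewrite addr_ge0 // mulr_ge0 // subr_ge0.
apply/ler_addgt0Pr => e e0; have e2 : 0 < e / 4 by lra.
have k0 : (0 < k)%N.
  by have := ltn_ord (xi (fun=> 0)); exact: leq_ltn_trans.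
have kR : 0 < k%:R :> R by rewrite ltr0n.
(* [expR B >= B], so this [B] makes [k * expR (- B)] at most [q]. *)
pose q : R := 1 - expR (- (e / 4)); have q0 : 0 < q.
  by rewrite subr_gt0 expR_lt1; lra.
pose B := k%:R / q; have B0 : 0 < B by rewrite divr_gt0.
have AB : expR (- (e / 4)) + k%:R * expR (- B) <= 1.
  rewrite -lerBrDl -/q expRN ler_pdivrMr ?expR_gt0 // mulrC -ler_pdivrMr // -/B.
  by apply: le_trans (expR_ge1Dx B); lra.
have eB : 0 < e / 4 / B by rewrite divr_gt0.
have [m [f [fw mbad hbad]]] := approx_partition mu mxi eB.
have hb : pr mu [set x | xi x != f x] * B <= e / 4.
  by rewrite -ler_pdivlMr // ltW.
pose K := ln 2 + ln C + m.*2%:R * b.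
have bound n : joint_entropy mu Defs.shift xi n <= K + n%:R * (b + e / 2).
  have pos (u : R) : 1 <= u -> 0 < C * u ^+ (n + m.*2).
    by move=> u1; rewrite mulr_gt0 ?exprn_gt0 //; lra.
  have lnE (u : R) : 1 <= u -> ln (C * u ^+ (n + m.*2)) = ln C + (n%:R + m.*2%:R) * ln u.
    move=> u1; rewrite lnM ?posrE ?exprn_gt0 //; try lra.
    by rewrite lnXn; [rewrite -[ln u *+ _]mulr_natl natrD | lra].
  have := gibbs_bound mxi fw (ltW e2) AB (pos _ t1) (pos _ t'1) (sL _) (sV _)
    (LWP m _) (VWP m _) mbad.
  rewrite !lnE // => /le_trans; apply.
  have : n%:R * (e / 4 + pr mu [set x | xi x != f x] * B) <= n%:R * (e / 2).
    by apply: ler_wpM2l => //; lra.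
  by rewrite /K /b; lra.
have h0 : 0 <= b + e by lra.
have near_le : \forall n \near \oo, joint_entropy mu Defs.shift xi n / n%:R <= b + e.
  exists (Num.trunc (K / (e / 2))).+1 => //= n /= hn.
  have n0 : 0 < n%:R :> R by rewrite ltr0n; exact: leq_trans hn.
  rewrite ler_pdivrMr //; apply: (le_trans (bound n)).
  have : K / (e / 2) <= n%:R.
    apply: (le_trans (ltW (truncnS_gt _))); by rewrite ler_nat.
  by rewrite ler_pdivrMr; lra.
rewrite /partition_entropy.
have [c|nc] := pselect (cvgn (fun n => joint_entropy mu Defs.shift xi n / n%:R)).
  exact: limr_le.
by rewrite dvgP.
Qed.

End GibbsBound.

(** * Recurrence and maximal entropy *)

Lemma alt_lt_asym (x y : nat -> int) : alt_lt x y -> ~ alt_le y x.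
Proof.
move=> [k [ek tk]] [[j [ej tj]]|e]; last by move: tk; rewrite e subrr mulr0.
have [kj|jk|kj] := ltngtP k j.
- by move: tk; rewrite ej // subrr mulr0.
- by move: tj; rewrite ek // subrr mulr0.
- by move: tj; rewrite -kj -opprB mulrN oppr_lt0 => /lt_trans/(_ tk).
Qed.

Lemma alt_lt_local (x y : nat -> int) : alt_lt x y ->
  exists k, forall x' y', (forall i, (i <= k)%N -> x' i = x i /\ y' i = y i) -> alt_lt x' y'.
Proof.
move=> [k [ek tk]]; exists k => x' y' h; exists k; split.
  by move=> i ik; have [-> ->] := h i (ltnW ik); exact: ek.
by have [-> ->] := h k (leqnn k).
Qed.

Section Occurrences.
Variables (R : realType) (mu : probability borel_biseq R).
Hypothesis mu_inv : forall A, measurable A -> mu (Defs.shift @^-1` A) = mu A.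

Definition occurs (w : seq int) (m : int) : set borel_biseq := [set x | occurs_at x m w].

Lemma occurs_open w m : open (occurs w m : set biseq).
Proof.
apply: agree_open => x xw; exists (`|m| + size w)%N => y xy i iw.
by rewrite xy ?xw //; lia.
Qed.

Lemma occurs_measurable w m : measurable (occurs w m).
Proof. by apply: sub_sigma_algebra; exact: occurs_open. Qed.

Lemma occurs_shift w m : Defs.shift @^-1` (occurs w m) = occurs w (m + 1).
Proof.
by apply/seteqP; split=> x /= h i /h <-; rewrite /Defs.shift addrAC.
Qed.

Lemma occurs_inv w m : mu (occurs w m) = mu (occurs w 0).
Proof.
have step k : mu (occurs w (k + 1)) = mu (occurs w k).
  by rewrite -occurs_shift mu_inv //; exact: occurs_measurable.
case: (intP m) => [//|n|n].
  elim: n => [|n <-]; first exact: (step 0).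
  by rewrite -(step n.+1%:Z); congr (mu (occurs w _)); lia.
elim: n => [|n <-]; first by rewrite -(step (- 1%:Z)) addNr.
by rewrite -(step (- n.+2%:Z)); congr (mu (occurs w _)); lia.
Qed.

Definition recurrent (w : seq int) : set borel_biseq :=
  \bigcap_N \bigcup_(n in [set n | (N <= n)%N]) occurs w n%:Z.

Let visits w N : set borel_biseq := \bigcup_(n in [set n | (N <= n)%N]) occurs w n%:Z.

Let visits_measurable w N : measurable (visits w N).
Proof. by apply: bigcup_measurable => n _; exact: occurs_measurable. Qed.

Lemma recurrent_measurable w : measurable (recurrent w).
Proof. by apply: bigcapT_measurable => N; exact: visits_measurable. Qed.

(** Poincare recurrence: the decreasing sets [visits w N] are shifts of each other,
so they all have the probability of [visits w 0], and so has their limit. *)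
Lemma recurrent_pr w : pr mu (occurs w 0) <= pr mu (recurrent w).
Proof.
have mG := recurrent_measurable w.
have visE N : pr mu (visits w N) = pr mu (visits w 0).
  elim: N => // N <-; rewrite /pr -[in RHS]mu_inv //; congr (fine (mu _)).
  apply/seteqP; split=> x.
    move=> [[//|n] /= Nn xw]; exists n => //=.
    by move: xw; rewrite -addn1 PoszD -occurs_shift.
  by move=> [n /= Nn xw]; exists n.+1 => //=; rewrite -addn1 PoszD -occurs_shift.
have le0 : pr mu (occurs w 0) <= pr mu (visits w 0).
  by apply: pr_le => //; [exact: occurs_measurable | move=> x xw; exists 0%N].
apply: (le_trans le0); rewrite leNgt; apply/negP => lt.
have e0 : 0 < pr mu (visits w 0) - pr mu (recurrent w) by rewrite subr_gt0.
have [||| N hN] := @pr_decreasing _ _ _ mu (fun N => visits w N `\` recurrent w) _ _ _ _ e0.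
- by move=> N; exact: measurableD.
- by move=> N x [[n /= Nn xn] nG]; split=> //; exists n => //=; exact: ltnW.
- apply/seteqP; split=> // x h; have [_ nG] := h 0%N I; apply: nG => N _.
  by have [] := h N I.
have mD : measurable (visits w N `\` recurrent w) by exact: measurableD.
have := prU mu mD mG.
have : pr mu (visits w N) <= pr mu ((visits w N `\` recurrent w) `|` recurrent w).
  apply: pr_le => //; first exact: measurableU.
  by move=> x vx; have [Gx|nGx] := pselect (recurrent w x); [right | left].
by rewrite visE; lra.
Qed.

End Occurrences.

Section NegativeBetaShift.
Variables (R : realType) (beta : R).
Hypothesis b_lt : beta < -1.

Let d := char_seq beta.
Let l := beta_l beta.
Let r := l + 1.
Let s := - beta.
Let S := negbeta_shift beta.

Let br : beta * r = l := beta_rl b_lt.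
Let o0 := char_orbit0 beta.
Let oS := char_orbitS b_lt.
Let o_in := char_orbit_in beta.
Let o_l := @char_orbit_l _ beta.
Let o_r := @char_orbit_r _ beta.

Let tail_tail_from (x : borel_biseq) m i : tail (tail_from x m) i = tail_from x (m + i%:Z).
Proof. by apply: funext => j; rewrite /tail /tail_from PoszD addrA. Qed.

Lemma upper_seqP (x : nat -> int) : alt_le d (tail x 1) ->
  alt_le x (upper_seq beta) <-> 0 <= x 0%N.
Proof.
move=> dx; split=> [[[[|k] [ek tk]]|->] //|].
- by move: tk; rewrite expr1 mulN1r oppr_lt0 subr0 => /ltW.
- by rewrite ek.
rewrite le_eqVlt => /orP[/eqP x0|x0]; last first.
  by left; exists 0%N; split=> //; rewrite expr1 mulN1r oppr_lt0 subr0.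
case: dx => [[k [ek tk]]|e].
  left; exists k.+1; split=> [[|i] //= ik|]; first exact/esym/ek.
  by rewrite exprS mulN1r /= mulNr -mulrN opprB; exact: tk.
by right; apply: funext => -[|i] //=; rewrite -/d e.
Qed.

Lemma negbeta_shiftP (x : borel_biseq) : S x <-> forall m, admissible d (tail_from x m).
Proof.
split=> [Sx m i|h m].
  have [h1 h2] := Sx (m + i%:Z); rewrite tail_tail_from; split=> //.
  have := (@upper_seqP (tail_from x (m + i%:Z)) _).1 h2.
  rewrite tail_tail_from; move=> /(_ (Sx _).1).
  by rewrite /tail_from addr0.
have [h0 h1] := h m 0%N; rewrite tail0 in h1; split=> //.
by apply/upper_seqP => //; have [_ h2] := h m 1%N.
Qed.

(** A violated inequality is strict the other way, hence visible on a window. *)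
Lemma negbeta_shift_measurable : measurable S.
Proof.
rewrite -[S]setCK; apply: measurableC; apply: measurable_agree => x nSx.
have [m hm] : exists m, ~ (alt_le d (tail_from x m) /\ alt_le (tail_from x m) (upper_seq beta)).
  by apply: contrapT => h; apply: nSx => m; apply: contrapT => h'; apply: h; exists m.
have H y k : agree (`|m| + k) x y -> forall i, (i <= k)%N -> tail_from y m i = tail_from x m i.
  by move=> xy i ik; rewrite /tail_from xy //; lia.
have [h|lt] := alt_total d (tail_from x m); last first.
  have [k hk] := alt_lt_local lt.
  exists (`|m| + k)%N => y xy /(_ m)[+ _]; apply/alt_lt_asym/hk => i ik.
  by rewrite (H y k).
have [h'|lt] := alt_total (tail_from x m) (upper_seq beta); first by case: hm.
have [k hk] := alt_lt_local lt.
exists (`|m| + k)%N => y xy /(_ m)[_ +]; apply/alt_lt_asym/hk => i ik.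
by rewrite (H y k).
Qed.

Let d0_gt0 : 0 < d 0%N.
Proof.
rewrite -(ltr_int R); have /andP[_] := o_in 1; rewrite oS o0 -/l -/d => h.
by have := br; rewrite /r mulrDr mulr1 => h'; have := b_lt; lra.
Qed.

(** Zeros can be put on the left since [d] starts with a positive digit. *)
Lemma admissible_extend (y : nat -> int) : admissible d y ->
  exists2 x, S x & forall i : nat, (x : int -> int) i = y i.
Proof.
move=> ay; pose x : borel_biseq := fun i : int => if i is Posz n then y n else 0.
exists x => //; apply/negbeta_shiftP => m i; rewrite tail_tail_from /tail_from.
case: (m + i%:Z) => [n|n].
  have [h1 h2] := ay n; split; [exact: h1 | exact: h2].
split=> //; left; exists 0%N; split=> //.
by rewrite expr1 mulN1r oppr_lt0 subr_gt0; exact: d0_gt0.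
Qed.

Lemma language_admissible (y : nat -> int) n : admissible d y -> language S (mkseq y n).
Proof.
move=> /admissible_extend[x Sx xy]; exists x, 0; split=> // i.
by rewrite size_mkseq => i_n; rewrite add0r xy nth_mkseq.
Qed.

Lemma language_word w : language S w -> exists2 y, admissible d y & w = mkseq y (size w).
Proof.
move=> [x [m [/negbeta_shiftP Sx xw]]]; exists (tail_from x m) => //.
apply: (@eq_from_nth _ 0) => [|i iw]; first by rewrite size_mkseq.
by rewrite nth_mkseq // /tail_from xw.
Qed.

Lemma language_factor w1 w w2 : language S (w1 ++ w ++ w2) -> language S w.
Proof.
move=> [x [m [Sx h]]]; exists x, (m + (size w1)%:Z); split=> // i iw.
have := h (size w1 + i)%N; rewrite !size_cat PoszD addrA => ->.
  by rewrite nth_cat ltnNge leq_addr /= addKn nth_cat iw.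
by rewrite ltn_add2l ltn_addr.
Qed.

Lemma wcat_prefix w z n : mkseq (wcat w z) (size w + n) = w ++ mkseq z n.
Proof.
elim: w => [|a w IH] //=; rewrite addSn -IH.
have := mkseq_tail (wcat (a :: w) z) 0 (size w + n); rewrite tail0 => ->.
by rewrite /wcat /= tail_cons tail0.
Qed.

(** The word [u] that never leads to [t] leads to every admissible sequence close
to the left end point, so [t] does not occur in these sequences. *)
Lemma intransitive_hole t : intransitive (language S) t ->
  exists2 e : R, 0 < e & forall z j, admissible d z ->
    (forall i, (i < size t)%N -> z (j + i)%N = nth 0 t i) -> l + e <= phi beta z.
Proof.
move=> [_ [u /language_word[y ay uE] hu]].
have [v [e e0 he]] := reach b_lt erefl br o0 oS o_in o_l o_r (size u) ay.
exists e => // z j az zt; rewrite leNgt; apply/negP => ze.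
have tE : mkseq z (j + size t) = mkseq z j ++ t.
  rewrite /mkseq iotaD map_cat add0n; congr (_ ++ _).
  rewrite -[j in iota j _]addn0 iotaDl -map_comp.
  apply: (@eq_from_nth _ 0) => [|i]; first by rewrite size_map size_iota.
  by rewrite size_map size_iota => it; rewrite (nth_map 0%N) ?size_iota // nth_iota //= zt.
have aw := he z az ze; rewrite -uE in aw.
have Lw := language_admissible (size (u ++ v) + (j + size t)) aw.
rewrite wcat_prefix tE in Lw.
apply: (hu (v ++ mkseq z j)).
  by apply: (@language_factor u _ t); move: Lw; rewrite -!catA.
by move: Lw; rewrite -!catA.
Qed.

Section Measures.
Variable mu : probability borel_biseq R.
Hypothesis mu_max : max_entropy_measure beta mu.

Let mu_inv A : measurable A -> mu (Defs.shift @^-1` A) = mu A.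
Proof. exact: (mem_invariant mu_max). Qed.

Let S1 : pr mu S = 1.
Proof. by rewrite /pr (mem_carried mu_max). Qed.

Lemma cylinder_occurs w : mu (cylinder S w) = mu (occurs w 0).
Proof.
have mS := negbeta_shift_measurable; have mo := occurs_measurable w 0.
have -> : cylinder S w = S `&` occurs w 0 by [].
rewrite prE; last exact: measurableI.
by rewrite (prE _ mo) (pr_full mS mo S1).
Qed.

(** Otherwise the recurrent points, of probability [p > 0], use fewer words than
the entropy requires. *)
Lemma max_entropy_intransitive t : intransitive (language S) t -> pr mu (occurs t 0) = 0.
Proof.
move=> /intransitive_hole[e e0 he].
apply/eqP; rewrite eq_le pr_ge0 andbT leNgt; apply/negP => t0.
have p0 : 0 < pr mu (recurrent t) := lt_le_trans t0 (recurrent_pr mu_inv t).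
set p := pr mu _ in p0.
have s1 : 1 < s by rewrite /s; have := b_lt; lra.
(* Half of the hole is kept as a margin for perturbations; the minimum with 1
   keeps [lp] below [r]. *)
pose lp := l + Num.min e 1 / 2.
have m0 : 0 < Num.min e 1 / 2 by rewrite divr_gt0 // lt_min e0 ltr01.
have m1 : Num.min e 1 / 2 <= 1 / 2 by rewrite ler_pM2r ?invr_gt0 // ge_min lexx orbT.
have me : Num.min e 1 / 2 <= e / 2 by rewrite ler_pM2r ?invr_gt0 // ge_min lexx.
have lpr : lp < r by rewrite /lp /r; lra.
have lr : l < r by rewrite /r; lra.
have rlp : r <= lp + 1 by rewrite /lp /r; lra.
have rlp' : r < lp + 1 by rewrite /lp /r; lra.
have [t' [t'1 t's [C' C'1 hC']]] := growth_below `|d 0%N|%N b_lt lpr rlp rlp'.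
have lns : ln t' < ln s by rewrite ltr_ln // posrE; lra.
pose k := p * (ln s - ln t').
have k0 : 0 < k by rewrite mulr_gt0 // subr_gt0.
(* This close to [s] the part of probability [1 - p] cannot make up for [k]. *)
pose T := s * expR (k / 2).
have sT : s < T by rewrite /T ltr_pMr ?expR_gt1; lra.
have lnT : ln T = ln s + k / 2 by rewrite /T lnM ?posrE ?expR_gt0 ?expRK //; lra.
have [C C1 hC] := growth_above `|d 0%N|%N b_lt lr (lexx r) sT.
have CC (u : R) n : 1 <= u -> C * u ^+ n <= (C + C') * u ^+ n /\ C' * u ^+ n <= (C + C') * u ^+ n.
  by move=> u1; have := exprn_ege1 n u1; split; rewrite mulrDl ?lerDl ?lerDr mulr_ge0 //; lra.
have T1 : 1 <= T by lra.
have := @entropy_bound _ mu mu_inv S (recurrent t) negbeta_shift_measurable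
  (recurrent_measurable t) S1 (C + C') T t' (live_words beta d r l) (live_words beta d r lp)
  _ T1 t'1 _ _ _ _.
rewrite (mem_entropy mu_max) lee_fin -/p ltr0_norm; last by have := b_lt; lra.
have H : p * ln t' + (1 - p) * ln T < ln s.
  have e1 : p * ln t' + (1 - p) * ln T = ln s - k + k / 2 - p * k / 2 by rewrite lnT /k; field.
  by rewrite e1; have := mulr_gt0 p0 k0; lra.
move=> HH; move: H; apply/negP; rewrite -leNgt; apply: HH.
- by lra.
- by move=> n; rewrite size_live_words; apply: le_trans (hC n) _; have [] := CC T n T1.
- by move=> n; rewrite size_live_words; apply: le_trans (hC' n) _; have [] := CC t' n t'1.
- move=> m n x /negbeta_shiftP/(_ (- m%:Z)) ax.
  by apply: (survivor_words b_lt erefl br o0 oS o_in o_l o_r n (lexx l) lr ax); left.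
- move=> m n x /negbeta_shiftP Sx Gx.
  have llp : l <= lp by rewrite /lp lerDl ltW.
  apply: (survivor_words b_lt erefl br o0 oS o_in o_l o_r n llp lpr (Sx (- m%:Z))); right.
  exists (Num.min e 1 / 2) => // i.
  have [j /= jN xj] := Gx (m + i)%N I.
  have h : forall q, (q < size t)%N ->
      tail (tail_from x (- m%:Z)) i ((j + m - i)%N + q) = nth 0 t q.
    move=> q qt; have <- := xj q qt; rewrite /tail /tail_from.
    have -> : (i + (j + m - i + q) = m + (j + q))%N by move: jN; clear; lia.
    by congr (x _); rewrite !PoszD addKr.
  apply: le_trans (he _ _ (admissible_tail i (Sx _)) h); rewrite /lp; lra.
Qed.

End Measures.

End NegativeBetaShift.

Unset Implicit Arguments.

Theorem theorem7 (R : realType) (beta : R) (beta_lt : beta < -1)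
    (mu : probability borel_biseq R) (mu_max : max_entropy_measure beta mu) :
  (forall P : set (seq int),
     prefix_code P \/ suffix_code P ->
     codes_support mu P ->
     positive_recurrent R P ->
     forall x : seq int, free_monoid P x ->
       (0 < mu (cylinder (negbeta_shift beta) x))%E) /\
  (forall t : seq int,
     intransitive (language (negbeta_shift beta)) t ->
     mu (cylinder (negbeta_shift beta) t) = 0%E).
Proof.
split=> [P _ supp _ x Px|t tL]; rewrite cylinder_occurs //; last first.
  by rewrite (prE mu (occurs_measurable t 0)) (max_entropy_intransitive beta_lt mu_max tL).
have : language (msupport mu) x by rewrite supp; exists [::], [::]; rewrite cats0.
move=> [y [m [ys yx]]]; rewrite -(occurs_inv (mem_invariant mu_max) x m).
exact: ys (occurs_open x m) yx.
Qed.
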